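(* Suppose that for all non-negative integers $m\ge n$ and all lists $L,M$ one has $\beta(M,m,L,n)>\beta(M,n-1,L,m+1)$. Then for all non-negative integers $m_1,n_1,m_2,n_2$ with $m_1+n_1=m_2+n_2$ and $|m_1-n_1|<|m_2-n_2|$, and all lists $L,M,N$, one has $\beta(M,m_1,L,n_1,N)>\beta(M,m_2,L,n_2,N)$.
   Context: Lists may be empty. A nonempty list $(p_1,\dots,p_r)$ of non-negative integers denotes the word $\mathbf c^{p_1}\mathbf d\mathbf c^{p_2}\mathbf d\cdots\mathbf d\mathbf c^{p_r}$ in non-commuting variables $\mathbf c$ (degree 1), $\mathbf d$ (degree 2); commas denote concatenation of lists; a list with a negative entry denotes $0$ and has $\beta$ value $0$. For a graded poset $P$ of rank $r+1$ with $\hat0,\hat1$ and $S\subseteq[r]$, $f_S$ counts chains $\hat0<x_1<\dots<x_j<\hat1$ with rank set $S$, $h_S=\sum_{T\subseteq S}(-1)^{|S-T|}f_T$, and the ab-index is $\sum_S h_S u_1\cdots u_r$ with $u_i=\mathbf b$ if $i\in S$, $\mathbf a$ otherwise. For Eulerian $P$ it is uniquely a polynomial $\Psi(P)$ in $\mathbf c=\mathbf a+\mathbf b$, $\mathbf d=\mathbf a\mathbf b+\mathbf b\mathbf a$. $B_{r+1}$ is the Boolean lattice of subsets of $[r+1]$. For a word $v$ of degree $r$, $\beta(v)$ is the coefficient of $v$ in $\Psi(B_{r+1})$; $\beta$ of a list is $\beta$ of the word it denotes. *)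

(* Defs.v *)
From HB Require Import structures.
From mathcomp Require Import all_boot all_order all_algebra.
From mathcomp.multinomials Require Import monalg.
From mathcomp Require classical_sets.

Set Implicit Arguments.
Unset Strict Implicit.
Unset Printing Implicit Defensive.

Import Order.TTheory GRing.Theory Num.Theory.
Import Order.DefaultSetSubsetOrder.
Local Open Scope ring_scope.

Section Posets.
Context {d : Order.disp_t} {P : finTBPOrderType d}.

Definition covered (x y : P) : bool :=
  (x < y)%O && ~~ [exists z : P, (x < z)%O && (z < y)%O].

(* A rank function making P a graded poset of rank r+1. *)
Record grading (r : nat) := Grading {
  rk :> P -> nat;
  rk_bot : rk \bot%O = 0%N;
  rk_top : rk \top%O = r.+1;
  rk_cover : forall x y, covered x y -> rk y = (rk x).+1 }.

Definition is_chain (C : {set P}) : bool :=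
  [forall x in C, (\bot < x < \top)%O]
  && [forall x in C, forall y in C, (x >=< y)%O].

Variables (r : nat) (rho : grading r).

(* Subsets of [r] = {1, ..., r} are encoded as S : {set 'I_r}, the ordinal i
   standing for the rank i+1. *)
Definition has_rank_set (C : {set P}) (S : {set 'I_r}) : bool :=
  [forall i : 'I_r, (i \in S) == [exists x in C, rho x == i.+1]].

Definition flag_f (S : {set 'I_r}) : nat :=
  #|[set C : {set P} | is_chain C && has_rank_set C S]|.

Definition flag_h (S : {set 'I_r}) : int :=
  \sum_(T : {set 'I_r} | T \subset S) (-1) ^+ #|S :\: T| * (flag_f T)%:Z.

End Posets.

Arguments grading {d} P r.

(* {fmonom bool} is the free monoid on two letters, and {malg int[{fmonom bool}]}
   the ring of integer polynomials in two non-commuting variables. In ab-words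
   false is a and true is b; in cd-words false is c and true is d. *)
Notation ab_poly := {malg int[{fmonom bool}]}.
Notation cd_word := {fmonom bool}.
Notation cd_poly := {malg int[{fmonom bool}]}.

Definition var_a : ab_poly := << fmu false >>.
Definition var_b : ab_poly := << fmu true >>.

Definition ab_index (d : Order.disp_t) (P : finTBPOrderType d) (r : nat)
    (rho : grading P r) : ab_poly :=
  \sum_(S : {set 'I_r})
     flag_h rho S *: \prod_(i < r) (if i \in S then var_b else var_a).

Definition cd_letter (l : bool) : ab_poly :=
  if l then var_a * var_b + var_b * var_a else var_a + var_b.

Definition cd_expand (Phi : cd_poly) : ab_poly :=
  mmap intr (fun w : cd_word => \prod_(l <- (w : seq bool)) cd_letter l) Phi.

(* The cd-index: the unique cd-polynomial expanding to the ab-index. Such a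
   polynomial exists for Eulerian posets; the value is 0 when there is none. *)
Definition cd_index (d : Order.disp_t) (P : finTBPOrderType d) (r : nat)
    (rho : grading P r) : cd_poly :=
  classical_sets.xget 0 (fun Phi : cd_poly => cd_expand Phi = ab_index rho).

Section Boolean.
Variable r : nat.
Notation B := {set 'I_r.+1}.

Definition bool_rank (A : B) : nat := #|A|.

Fact bool_rank_bot : bool_rank \bot%O = 0%N.
Proof. exact: cards0. Qed.

Fact bool_rank_top : bool_rank \top%O = r.+1.
Proof. by rewrite -[RHS]card_ord -cardsT. Qed.

Fact bool_rank_cover (A C : B) :
  covered A C -> bool_rank C = (bool_rank A).+1.
Proof.
case/andP=> ltAC noz.
have /properP[sAC [x xC xA]] : A \proper C.
  by rewrite properEneq -[A \subset C]/(A <= C)%O -lt_neqAle.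
pose D : B := x |: A.
have ltAD : (A < D)%O.
  rewrite lt_neqAle; apply/andP; split; last exact: subsetU1.
  by apply: contraNneq xA => ->; rewrite setU11.
have leDC : (D <= C)%O.
  by apply/subsetP=> z; rewrite !inE => /predU1P[->|/(subsetP sAC)].
have <- : D = C.
  apply/eqP; apply: contraR noz => neDC; apply/existsP; exists D.
  by rewrite ltAD lt_neqAle neDC.
by rewrite /bool_rank cardsU1 xA.
Qed.

Definition boolean_grading : grading B r :=
  Grading bool_rank_bot bool_rank_top bool_rank_cover.

End Boolean.

Definition cd_degree (w : cd_word) : nat :=
  \sum_(l <- (w : seq bool)) (if l then 2 else 1)%N.

Definition beta_word (w : cd_word) : int :=
  (cd_index (boolean_grading (cd_degree w)))@_w.

(* c^p d c^(q_1) d ... d c^(q_k), for the list p, q_1, ..., q_k. *)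
Definition list_word (p : nat) (s : seq nat) : cd_word :=
  FMonom (nseq p false ++ flatten [seq true :: nseq q false | q <- s]).

(* Lists with a negative entry denote 0; the empty list denotes no word and gets
   a dummy value. *)
Definition beta (s : seq int) : int :=
  if all (fun x => 0 <= x) s then
    if [seq `|x|%N | x <- s] is p :: s' then beta_word (list_word p s') else 0
  else 0.

Definition ints (s : seq nat) : seq int := [seq n%:Z | n <- s].

(* Main.v *)
(** Put bt(P) = beta(P) / (deg P + 1)! for a list P.  The pyramid operator
    p |-> p c + G(p), G the derivation with G(a) = ba and G(b) = ab, maps the
    ab-index of B_n to that of B_(n+1), because both sides satisfy the recursion
    obtained by splitting a chain at its top element.  Since G(c) = d and
    G(d) = cd, this gives

      (deg P + 1) bt(P) = sum of bt(Q) over all Q obtained from P by decrementing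
                          an entry or by merging neighbours x, y into x + y + 1,

    whence, by induction,

      bt(A, a) bt(b, B) = bt(A, a-1, b, B) + bt(A, a, b-1, B) + 2 bt(A, a+b+1, B).

    The second identity trades a merge across a cut for a product, and every
    estimate is an induction on the degree after such trades at well chosen cuts:
    (j+2) bt(M, j+1, L) <= bt(M, j, L), bt(j, N) <= (j+3) bt(j+1, N), and
    prefixing M multiplies bt(a, Z) by a factor that essentially decreases with a.
    In the theorem one may assume m2 > n2, by reversal.  If m2 = n1 + 1, the
    reversed hypothesis is the claim for M empty, and the prefix estimate extends
    it to all M.  Otherwise cut (M, m, L, n, N) after M, before n and after n: all
    terms but bt(M, m, L) bt(n, N) compare by induction, and this product compares
    by the two one-entry estimates. *)

From HB Require Import structures.
Require Import Defs.
From mathcomp Require Import all_boot all_order all_algebra.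
From mathcomp Require Import ring lra zify.
From mathcomp.multinomials Require Import monalg.
From mathcomp Require classical_sets.
Import Order.TTheory GRing.Theory Num.Theory.
Import Order.DefaultSetSubsetOrder.
Local Open Scope ring_scope.

Set Implicit Arguments.
Unset Strict Implicit.
Unset Printing Implicit Defensive.

Implicit Types (u v w : seq bool) (p q : ab_poly).

(** * The pyramid operator *)

(* Words and coefficients are locked: unification diverges on unfolded products
   of the monoid algebra. *)
HB.lock Definition wd (w : seq bool) : ab_poly := << FMonom w >>.

Lemma wd_cat u v : wd (u ++ v) = wd u * wd v.
Proof. by rewrite wd.unlock malgM_def fgmulUU mul1r /mmul /= fmmulE. Qed.

Lemma wd_cons x w : wd (x :: w) = wd [:: x] * wd w.
Proof. by rewrite -wd_cat. Qed.

Lemma wd_nil : wd [::] = 1.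
Proof. by rewrite wd.unlock -fmoneE. Qed.

HB.lock Definition coef (p : ab_poly) (v : seq bool) : int := p@_(FMonom v).

Lemma coefB p q v : coef (p - q) v = coef p v - coef q v.
Proof. by rewrite coef.unlock mcoeffB. Qed.

Lemma coefD p q v : coef (p + q) v = coef p v + coef q v.
Proof. by rewrite coef.unlock mcoeffD. Qed.

Lemma coef_sum (I : Type) (r : seq I) (F : I -> ab_poly) v :
  coef (\sum_(i <- r) F i) v = \sum_(i <- r) coef (F i) v.
Proof. by rewrite coef.unlock raddf_sum. Qed.

Lemma coef_wd w v : coef (wd w) v = (w == v)%:R.
Proof. by rewrite coef.unlock wd.unlock mcoeffU1 fmP. Qed.

(** Words generate the ring as an abelian group; this reduces the additive identities below to the
    case of words. *)
Lemma malg_additive_ext (V : zmodType) (f g : ab_poly -> V) :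
  zmod_morphism f -> zmod_morphism g ->
  (forall w, f (wd w) = g (wd w)) -> f =1 g.
Proof.
move=> fB gB fg p.
pose F : {additive ab_poly -> V} :=
  HB.pack f (GRing.isZmodMorphism.Build _ _ f fB).
pose G : {additive ab_poly -> V} :=
  HB.pack g (GRing.isZmodMorphism.Build _ _ g gB).
rewrite -[f]/(F : _ -> _) -[g]/(G : _ -> _) in fg *.
rewrite [p]monalgE !raddf_sum; apply: eq_bigr => k _.
have -> : << p@_k *g k >> = << k >> *~ p@_k.
  apply/malgP => k'; rewrite mcoeffU raddfMz /= mcoeffU1.
  by case: eqP => _; rewrite ?mulr1n ?mulr0n ?mul0rz // intz.
by rewrite !raddfMz; have := fg k; rewrite wd.unlock fmK => ->.
Qed.

Definition linext (h : seq bool -> ab_poly) : ab_poly -> ab_poly :=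
  mmap intr (fun k : {fmonom bool} => h k).
HB.instance Definition _ h := GRing.Additive.on (linext h).

Lemma linextU h w : linext h (wd w) = h w.
Proof.
transitivity ((1 : ab_poly) *~ 1 * h w); first by rewrite wd.unlock; exact: mmapU.
by rewrite mulr1z mul1r.
Qed.

(** On words, the derivation G with G(a) = ba and G(b) = ab, unfolded by the Leibniz rule at the
    first letter. *)
Fixpoint deriv_word w : ab_poly :=
  if w is x :: w' then
    wd (if x then [:: false; true] else [:: true; false]) * wd w'
      + wd [:: x] * deriv_word w'
  else 0.

Definition ab_deriv := linext deriv_word.
HB.instance Definition _ := GRing.Additive.on ab_deriv.

Lemma ab_derivU w : ab_deriv (wd w) = deriv_word w.
Proof. exact: linextU. Qed.

Lemma deriv_word_cat u v :
  deriv_word (u ++ v) = deriv_word u * wd v + wd u * deriv_word v.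
Proof.
(* Proved over an abstract ring, so that no product of the monoid algebra gets unfolded; the same
   device recurs below. *)
have leibniz (R : nzRingType) (g x y z s t : R) :
  g * (y * z) + x * (s * z + y * t) = (g * y + x * s) * z + x * y * t.
  by rewrite mulrDl mulrDr !mulrA addrA.
elim: u => [|x u IHu] /=; first by rewrite mul0r add0r wd_nil mul1r.
by rewrite IHu wd_cat [wd (x :: u)]wd_cons; apply: leibniz.
Qed.

Lemma ab_derivM p q : ab_deriv (p * q) = ab_deriv p * q + p * ab_deriv q.
Proof.
have leib (R : nzRingType) (x y r t s z : R) :
  x * (r - t) + y * (s - z) = x * r + y * s - (x * t + y * z).
  by rewrite !mulrBr opprD addrACA.
have leib' (R : nzRingType) (x y r t s z : R) :
  (r - t) * x + (s - z) * y = r * x + s * y - (t * x + z * y).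
  by rewrite !mulrBl opprD addrACA.
have deriv_wdM u r : ab_deriv (wd u * r) = deriv_word u * r + wd u * ab_deriv r.
  move: r; apply: malg_additive_ext => [x y|x y|v].
  - by rewrite mulrBr raddfB.
  - by rewrite raddfB; apply: leib.
  by rewrite -wd_cat !ab_derivU deriv_word_cat.
move: p; apply: malg_additive_ext => [x y|x y|u].
- by rewrite mulrBl raddfB.
- by rewrite raddfB; apply: leib'.
by rewrite deriv_wdM ab_derivU.
Qed.

Lemma var_aE : var_a = wd [:: false].
Proof. by rewrite wd.unlock /var_a fmuE. Qed.

Lemma var_bE : var_b = wd [:: true].
Proof. by rewrite wd.unlock /var_b fmuE. Qed.

Lemma ab_deriv_a : ab_deriv var_a = var_b * var_a.
Proof.
by rewrite var_aE var_bE ab_derivU /= wd_nil mulr0 addr0 mulr1 -wd_cat.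
Qed.

Lemma ab_deriv_b : ab_deriv var_b = var_a * var_b.
Proof.
by rewrite var_aE var_bE ab_derivU /= wd_nil mulr0 addr0 mulr1 -wd_cat.
Qed.

(** * The pyramid operator over an abstract ring *)

Section Pyramid.
Variables (R : nzRingType) (a b : R) (G : {additive R -> R}).
Hypothesis GM : forall x y, G (x * y) = G x * y + x * G y.
Hypotheses (Ga : G a = b * a) (Gb : G b = a * b).

Let c := a + b.
Let d := a * b + b * a.
Let e := a - b.

(* The pyramid operator of Ehrenborg and Readdy. *)
Definition pyr (x : R) : R := x * c + G x.

Lemma deriv1 : G 1 = 0.
Proof.
have := GM 1 1; rewrite !mulr1 mul1r => /(congr1 (fun x => x - G 1)).
by rewrite subrr addrK.
Qed.

Lemma deriv_c : G c = d.
Proof. by rewrite raddfD /= Ga Gb addrC. Qed.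

Lemma deriv_d : G d = c * d.
Proof.
rewrite raddfD /= !GM Ga Gb /c /d mulrDl !mulrDr !mulrA.
by rewrite (AC (2*2) ((2*3)*(1*4)))%AC.
Qed.

(** On [e] the derivation agrees with the commutator with [b]. The latter is a derivation as well,
    so they agree on all powers of [e]. *)
Lemma deriv_eX m : G (e ^+ m) = b * e ^+ m - e ^+ m * b.
Proof.
have Ge : G e = b * e - e * b.
  by rewrite /e raddfB /= Ga Gb mulrBr mulrBl opprB [RHS]addrA subrK.
clearbody e.
elim: m => [|m IHm]; first by rewrite expr0 deriv1 mulr1 mul1r subrr.
by rewrite exprS GM IHm Ge mulrBl mulrBr !mulrA addrA subrK.
Qed.

Lemma pyr_eX m : pyr (e ^+ m) = e ^+ m.+1 + e ^+ m * b + b * e ^+ m.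
Proof.
rewrite /pyr deriv_eX; have -> : c = e + b + b by rewrite /e subrK.
clearbody e.
by rewrite !mulrDr -exprSr [b * _ - _]addrC addrA addrK.
Qed.

(** The summand [b * b * e ^+ m] from [pyr_eX] and [a * b * e ^+ m] from [G b] add up to
    [c * b * e ^+ m], which completes [G x] to [pyr x]. *)
Lemma pyr_peel x m :
  pyr (x * b * e ^+ m) =
    pyr x * b * e ^+ m + x * b * e ^+ m.+1 + x * b * e ^+ m * b.
Proof.
have pyrM y z : pyr (y * z) = y * pyr z + G y * z.
  by rewrite /pyr GM; clearbody c; rewrite mulrDr mulrA -addrA [G y * _ + _]addrC.
rewrite -mulrA pyrM; have -> : pyr (b * e ^+ m) = b * pyr (e ^+ m) + a * b * e ^+ m.
  by rewrite pyrM Gb.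
rewrite pyr_eX /pyr /c; clearbody e; rewrite mulrDr !mulrDl !mulrDr !mulrA.
by rewrite !mulrDl (ACl (4*3*5*1*2))%AC.
Qed.

End Pyramid.

Section PyramidPeel.
Variables (R : nzRingType) (b e : R) (D : {additive R -> R}) (X : nat -> R).
Hypothesis D_eX : forall m, D (e ^+ m) = e ^+ m.+1 + e ^+ m * b + b * e ^+ m.
Hypothesis D_peel : forall x m, D (x * b * e ^+ m) =
    D x * b * e ^+ m + x * b * e ^+ m.+1 + x * b * e ^+ m * b.
Hypotheses (X0 : X 0 = 1) (XS : forall r, X r.+1 = D (X r)).

(** The k-th summand is the share of the chains whose top element has rank k+1. In the induction [D]
    turns it into three terms: one shifts k, one raises the exponent of [e], and these two combine
    by Pascal's rule; the third terms add up to [S * b], that is, [X r * b - e ^+ r * b]. *)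
Lemma pyramid_peel r :
  X r = e ^+ r
        + \sum_(k < r) X k * b * e ^+ (r - k.+1) *+ 'C(r.+1, k.+1).
Proof.
elim: r => [|r IHr]; first by rewrite big_ord0 addr0 expr0 X0.
set S := \sum_(k < r) _ in IHr.
have XrS : S * b = X r * b - e ^+ r * b by rewrite {1}IHr mulrDl addrAC subrr add0r.
rewrite XS {1}IHr raddfD /= D_eX raddf_sum /=.
under eq_bigr => k _ do rewrite raddfMn /= D_peel -XS !mulrnDl.
rewrite !big_split /=.
under [X in _ + (_ + X)]eq_bigr => k _ do rewrite -mulrnAl.
rewrite -mulr_suml -/S XrS.
rewrite [in RHS](eq_bigr (fun k : 'I_r.+1 =>
   X k * b * e ^+ (r.+1 - k.+1) *+ 'C(r.+1, k.+1)
   + X k * b * e ^+ (r.+1 - k.+1) *+ 'C(r.+1, k))); last first.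
  by move=> k _; rewrite binS mulrnDr.
rewrite big_split /= big_ord_recr /= [X in _ = _ + (_ + X)]big_ord_recl /=.
rewrite subSS subnn expr0 mulr1 binn mulr1n bin0 mulr1n X0 mul1r subSS subn0.
have -> : \sum_(k < r) X k.+1 * b * e ^+ (r - k.+1) *+ 'C(r.+1, k.+1)
        = \sum_(k < r) X (bump 0 k) * b * e ^+ (r.+1 - (bump 0 k).+1) *+ 'C(r.+1, bump 0 k).
  by apply: eq_bigr => k _; rewrite /bump subSS.
have -> : \sum_(k < r) X k * b * e ^+ (r - k.+1).+1 *+ 'C(r.+1, k.+1)
        = \sum_(k < r) X k * b * e ^+ (r.+1 - k.+1) *+ 'C(r.+1, k.+1).
  by apply: eq_bigr => k _; rewrite subSS subnSK.
set A := \sum_(k < r) _; set B := \sum_(k < r) _.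
by rewrite !addrA (ACl (1*5*6*3*4*(2*7)))%AC /= subrr addr0.
Qed.
End PyramidPeel.

(* The words of the pyramid of a cd-word w: w c, and the words obtained by one
   replacement c -> d or d -> cd. *)
Fixpoint up_words w : seq (seq bool) :=
  if w is x :: w' then
    ((if x then [:: false; true] else [:: true]) ++ w')
      :: [seq x :: u | u <- up_words w']
  else [:: [:: false]].

(** The transpose of [up_words]: d is undone to c, cd is undone to d, and a final c is dropped. *)
Fixpoint down_words w : seq (seq bool) :=
  if w is x :: w' then
    (if x then [:: false :: w']
     else match w' with
          | [::] => [:: [::]]
          | true :: _ => [:: w']
          | false :: _ => [::]
          end) ++ [seq x :: u | u <- down_words w']
  else [::].

Lemma count_up_down u w :
  count_mem w (up_words u) = count_mem u (down_words w).
Proof.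
have count_cons (x y : bool) v s :
    count_mem (x :: v) [seq y :: t | t <- s] = ((x == y) * count_mem v s)%N.
  rewrite count_map; have [->|xy] := eqVneq x y.
    by rewrite mul1n; apply: eq_count => t /=; rewrite eqseq_cons eqxx.
  rewrite mul0n; apply/eqP; rewrite -leqn0 leqNgt -has_count.
  by apply/hasPn => t _ /=; rewrite eqseq_cons eq_sym (negbTE xy).
elim: w u => [|y w IHw] [|x u] //=.
- by case: x; rewrite /= count_map; elim: (up_words u).
- rewrite count_cat addn0.
  have -> : count_mem [::] [seq y :: t | t <- down_words w] = 0%N.
    by rewrite count_map; elim: (down_words w).
  by case: y; case: w {IHw} => [|[] w].
rewrite count_cat !count_cons IHw [y == x]eq_sym; congr (_ + _)%N.
by case: x; case: y; case: w {IHw} => [|[] w] //=;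
   rewrite ?eqseq_cons //= ?addn0 // eq_sym.
Qed.

(** * The pyramid on cd-polynomials *)

Notation cd_expand_word w := (\prod_(l <- w) cd_letter l).

Fact cd_expand_is_additive : zmod_morphism cd_expand.
Proof. exact: mmap_is_additive. Qed.
HB.instance Definition _ := GRing.isZmodMorphism.Build cd_poly ab_poly cd_expand
  cd_expand_is_additive.

Lemma cd_expandU w : cd_expand (wd w) = cd_expand_word w.
Proof.
transitivity ((1 : ab_poly) *~ 1 * cd_expand_word w); last by rewrite mulr1z mul1r.
by rewrite wd.unlock; exact: mmapU.
Qed.

Definition cd_up := linext (fun w => \sum_(u <- up_words w) wd u).
HB.instance Definition _ := GRing.Additive.on cd_up.

Lemma cd_upU w : cd_up (wd w) = \sum_(u <- up_words w) wd u.
Proof. exact: linextU. Qed.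

Lemma coef_cd_up p w : coef (cd_up p) w = \sum_(u <- down_words w) coef p u.
Proof.
move: p; apply: malg_additive_ext => [x y|x y|u].
- by rewrite raddfB coefB.
- by rewrite -sumrB; apply: eq_bigr => v _; rewrite coefB.
rewrite cd_upU coef_sum.
under eq_bigr do rewrite coef_wd.
under [RHS]eq_bigr do rewrite coef_wd eq_sym.
have countE (s : seq (seq bool)) v : (\sum_(t <- s) (t == v) = count_mem v s)%N.
  by elim: s => [|t s IHs]; rewrite (big_nil, big_cons) //= IHs.
by rewrite -!natr_sum !countE count_up_down.
Qed.

Notation pyramid := (pyr var_a var_b ab_deriv).

(** By the Leibniz rule along the word: G(c) = d and G(d) = cd are the two replacements, and the
    appended c is the multiplication by c. *)
Lemma cd_expand_up p : cd_expand (cd_up p) = pyramid (cd_expand p).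
Proof.
have pyrB (R : nzRingType) (c x y gx gy : R) :
  (x - y) * c + (gx - gy) = x * c + gx - (y * c + gy).
  by rewrite mulrBl opprD addrACA.
move: p; apply: malg_additive_ext => [x y|x y|w].
- by rewrite !raddfB.
- by rewrite raddfB /pyr raddfB; apply: pyrB.
rewrite cd_upU cd_expandU raddf_sum /=.
under eq_bigr do rewrite cd_expandU.
elim: w => [|x w IHw] /=.
  rewrite big_seq1 big_cons big_nil /pyr mul1r mulr1 (deriv1 ab_derivM).
  by rewrite addr0.
rewrite big_cons big_cat big_cons /= big_map.
under [X in _ + X = _]eq_bigr do rewrite big_cons.
rewrite -mulr_sumr IHw /pyr [X in _ = _ + X]ab_derivM.
have key (R : nzRingType) (l g z c t : R) : g * z + l * (z * c + t) = l * z * c + (g * z + l * t).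
  by rewrite mulrDr mulrA addrCA.
have -> : cd_expand_word (if x then [:: false; true] else [:: true])
        = ab_deriv (cd_letter x).
  case: x; last by rewrite big_seq1 (deriv_c ab_deriv_a ab_deriv_b).
  rewrite !big_cons big_nil mulr1.
  by rewrite (deriv_d ab_derivM ab_deriv_a ab_deriv_b).
exact: key.
Qed.

(** This will turn out to be the cd-index of the Boolean lattice of rank r+1; the start 1 belongs to
    rank 1. *)
Definition boolean_cd r : cd_poly := iter r cd_up 1.

Lemma cd_expand_boolean_peel r :
  cd_expand (boolean_cd r) = (var_a - var_b) ^+ r
    + \sum_(k < r) cd_expand (boolean_cd k) * var_b * (var_a - var_b) ^+ (r - k.+1)
        *+ 'C(r.+1, k.+1).
Proof.
have pyrB : zmod_morphism (pyramid : ab_poly -> ab_poly).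
  move=> x y; rewrite /pyr raddfB.
  have key (R : nzRingType) (c s t gx gy : R) :
    (s - t) * c + (gx - gy) = s * c + gx - (t * c + gy).
    by rewrite mulrBl opprD addrACA.
  exact: key.
pose D : {additive ab_poly -> ab_poly} :=
  HB.pack (pyramid : ab_poly -> ab_poly) (GRing.isZmodMorphism.Build _ _ pyramid pyrB).
apply: (pyramid_peel (D := D) (X := fun r => cd_expand (boolean_cd r))).
- exact: (pyr_eX ab_derivM ab_deriv_a ab_deriv_b).
- exact: (pyr_peel ab_derivM ab_deriv_a ab_deriv_b).
- by rewrite /boolean_cd /= -wd_nil cd_expandU big_nil wd_nil.
- by move=> k; rewrite /= cd_expand_up.
Qed.

(** * Uniqueness of the cd-index *)

(** Here [h] gives the coefficients of p = c X + d Y + constant. The b-quotient of p is X + a Y and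
    the a-quotient is X + b Y; at a word starting with a they differ by a coefficient of Y alone. *)
Definition extract_d (h : seq bool -> int) v : int :=
  h (true :: false :: v) - h (false :: false :: v).

Definition extract_c (h : seq bool -> int) v : int :=
  h (false :: v) - (if v is true :: v' then extract_d h v' else 0).

(* If p = c X + d Y + constant with c = a + b, d = ab + ba, then Y is the
   a-quotient of the difference of the b- and a-quotients of p, and X + b Y is
   the a-quotient of p. *)
Fixpoint cd_extract w (h : seq bool -> int) : int :=
  if w is x :: w' then cd_extract w' (if x then extract_d h else extract_c h)
  else h [::].

Lemma eq_cd_extract w h1 h2 : h1 =1 h2 -> cd_extract w h1 = cd_extract w h2.
Proof.
elim: w h1 h2 => [|x w IHw] h1 h2 eqh //=; apply: IHw => v.
case: x; rewrite /extract_c /extract_d ?eqh //.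
by case: v => [|[] v]; rewrite ?eqh.
Qed.

Lemma cd_extractB w h1 h2 :
  cd_extract w (fun v => h1 v - h2 v) = cd_extract w h1 - cd_extract w h2.
Proof.
elim: w h1 h2 => [|x w IHw] h1 h2 //=; rewrite -IHw; apply: eq_cd_extract => v.
case: x; rewrite /extract_c /extract_d; first by ring.
by case: v => [|[] v]; ring.
Qed.

Lemma cd_extract0 w h : (forall v, h v = 0) -> cd_extract w h = 0.
Proof.
move=> h0; rewrite (@eq_cd_extract _ _ (fun v => h v - h v)) ?cd_extractB ?subrr //.
by move=> v; rewrite subrr.
Qed.

Lemma coef_wdM x p v :
  coef (wd [:: x] * p) v =
    if v is y :: v' then (if x == y then coef p v' else 0) else 0.
Proof.
move: p; apply: malg_additive_ext => [p q|p q|w].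
- by rewrite mulrBr coefB.
- by case: v => [|y v]; [|case: eqP => _]; rewrite ?subrr // coefB.
rewrite -wd_cat coef_wd; case: v => // y v.
by rewrite eqseq_cons; case: eqP => _ //=; rewrite coef_wd.
Qed.

Lemma coef_cM p v :
  coef (cd_letter false * p) v = if v is _ :: v' then coef p v' else 0.
Proof.
have -> : cd_letter false * p = wd [:: false] * p + wd [:: true] * p.
  by rewrite -var_aE -var_bE mulrDl.
rewrite coefD; transitivity (
  (if v is y :: v' then (if false == y then coef p v' else 0) else 0) +
  (if v is y :: v' then (if true == y then coef p v' else 0) else 0)).
  by congr (_ + _); apply: coef_wdM.
by case: v => // -[] v; rewrite /= ?add0r ?addr0.
Qed.

Lemma coef_dM p v :
  coef (cd_letter true * p) v =
    if v is x :: y :: v' then (if x == y then 0 else coef p v') else 0.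
Proof.
have key (R : nzRingType) (x y z : R) :
  (x * y + y * x) * z = x * (y * z) + y * (x * z) by rewrite mulrDl !mulrA.
have -> : cd_letter true * p = wd [:: false] * (wd [:: true] * p)
                              + wd [:: true] * (wd [:: false] * p).
  by rewrite -var_aE -var_bE; exact: (key _ var_a var_b p).
rewrite coefD; transitivity (
  (if v is y :: v' then (if false == y then coef (wd [:: true] * p) v' else 0) else 0) +
  (if v is y :: v' then (if true == y then coef (wd [:: false] * p) v' else 0) else 0)).
  by congr (_ + _); apply: coef_wdM.
case: v => // -[] v; rewrite /= ?add0r ?addr0; apply: etrans (coef_wdM _ _ _) _.
  by case: v => // -[].
by case: v => // -[].
Qed.

(** Each pass strips one letter: if it is the first letter of [u], the coefficients of the remaining
    product are left, otherwise only zeros. *)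
Lemma cd_extract_word w u : cd_extract w (coef (cd_expand_word u)) = (u == w)%:R.
Proof.
elim: w u => [|x w IHw] [|y u] /=.
- by rewrite big_nil -wd_nil coef_wd.
- by rewrite big_cons; case: y; rewrite (coef_dM, coef_cM).
- rewrite big_nil -wd_nil; apply: cd_extract0 => v.
  case: x; rewrite /extract_c /extract_d !coef_wd /= ?subrr //.
  by case: v => [|[] v]; rewrite ?coef_wd /= ?subrr.
rewrite big_cons eqseq_cons; case: x; case: y => /=.
- rewrite -IHw; apply: eq_cd_extract => v.
  by rewrite /extract_d !coef_dM /= subr0.
- apply: cd_extract0 => v.
  by rewrite /extract_d !coef_cM subrr.
- apply: cd_extract0 => v; rewrite /extract_c /extract_d.
  by case: v => [|[] v]; rewrite !coef_dM /= ?subr0 ?subrr.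
- rewrite -IHw; apply: eq_cd_extract => v; rewrite /extract_c /extract_d.
  by case: v => [|[] v]; rewrite !coef_cM ?subrr ?subr0.
Qed.

Lemma cd_expandK p w : cd_extract w (coef (cd_expand p)) = coef p w.
Proof.
move: p; apply: malg_additive_ext => [p q|p q|u].
- by rewrite -cd_extractB; apply: eq_cd_extract => v; rewrite raddfB coefB.
- by rewrite coefB.
by rewrite cd_expandU cd_extract_word coef_wd.
Qed.

Lemma cd_expand_inj : injective cd_expand.
Proof.
move=> p q eqpq; apply/malgP => k.
have := cd_expandK p k; rewrite eqpq cd_expandK coef.unlock.
by rewrite fmK.
Qed.

Lemma cd_index_eq (d : Order.disp_t) (P : finTBPOrderType d) r
    (rho : grading P r) Phi :
  cd_expand Phi = ab_index rho -> cd_index rho = Phi.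
Proof.
move=> PhiE; apply: classical_sets.xget_unique => // Phi' Phi'E.
by apply: cd_expand_inj; rewrite PhiE.
Qed.

(** * Chains in the Boolean lattice *)

Section Chains.
Variable T : finType.
Implicit Types (U X Y : {set T}) (C : {set {set T}}) (s : seq nat).

(** The cardinalities that occur are exactly those in [s]. A list is used, later sorted
    decreasingly, so that recursion can remove the top of the chain. *)
Definition chains U s : {set {set {set T}}} :=
  [set C : {set {set T}} | [&& [forall X in C, (X \subset U) && (#|X| \in s)],
               [forall X in C, forall Y in C, (X \subset Y) || (Y \subset X)]
             & all (fun k => [exists X in C, #|X| == k]) s]].

Lemma chainsP U s C :
  reflect [/\ forall X, X \in C -> X \subset U /\ #|X| \in s,
              forall X Y, X \in C -> Y \in C -> (X \subset Y) || (Y \subset X)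
            & forall k, k \in s -> exists2 X, X \in C & #|X| = k]
          (C \in chains U s).
Proof.
rewrite inE; apply: (iffP and3P) => -[H1 H2 H3]; split.
- by move=> X XC; move/forall_inP/(_ X XC)/andP: H1.
- by move=> X Y XC YC; move/forall_inP/(_ X XC)/forall_inP/(_ Y YC): H2.
- by move=> k ks; move/allP/(_ k ks)/exists_inP: H3 => [X XC /eqP]; exists X.
- by apply/forall_inP => X /H1 [-> ->].
- by apply/forall_inP => X XC; apply/forall_inP => Y YC; apply: H2.
- by apply/allP => k /H3 [X XC Xk]; apply/exists_inP; exists X; rewrite ?Xk.
Qed.

Lemma chains_nil U : chains U [::] = [set set0].
Proof.
apply/setP => C; rewrite in_set1; apply/chainsP/eqP => [[H1 _ _]|->].
  by apply/setP => X; rewrite inE; apply/negbTE/negP => /H1 [].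
by split => // [X|X Y]; rewrite inE.
Qed.

Lemma chain_eq_card U s C X Y :
  C \in chains U s -> X \in C -> Y \in C -> #|X| = #|Y| -> X = Y.
Proof.
case/chainsP => _ cmp _ XC YC XY; case/orP: (cmp X Y XC YC) => sub.
  by apply/eqP; rewrite eqEcard sub XY leqnn.
by apply/esym/eqP; rewrite eqEcard sub XY leqnn.
Qed.

(** All other members have fewer than k elements, so being comparable with [X] they lie inside
    [X]. *)
Lemma chains_cons U k s X : X \subset U -> #|X| = k -> all (ltn^~ k) s ->
  [set C in chains U (k :: s) | X \in C] = [set X |: C | C in chains X s].
Proof.
move=> XU Xk s_lt; apply/setP => C; rewrite in_set; apply/andP/imsetP.
  move=> [Cch XC]; case/chainsP: (Cch) => H1 H2 H3.
  exists (C :\ X); last by rewrite setD1K.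
  apply/chainsP; split.
  - move=> Y; rewrite !inE => /andP[YX YC]; have [YU] := H1 Y YC.
    rewrite inE => /predU1P[Yk|Ys].
      by rewrite (chain_eq_card Cch YC XC) ?eqxx ?Yk // in YX.
    split=> //; case/orP: (H2 X Y XC YC) => // XY.
    have /allP/(_ _ Ys)/= := s_lt; rewrite -Xk ltnNge => /negP[].
    exact: subset_leq_card.
  - by move=> Y Z; rewrite !inE => /andP[_ YC] /andP[_ ZC]; apply: H2.
  - move=> j js; have [|Y YC Yj] := H3 j; first by rewrite inE js orbT.
    exists Y => //; rewrite !inE YC andbT; apply/eqP => YX.
    by move/allP/(_ _ js): s_lt; rewrite /= -Yj YX Xk ltnn.
move=> [D /chainsP[H1 H2 H3] ->]; split; last exact: setU11.
apply/chainsP; split.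
- move=> Y; rewrite !inE => /predU1P[->|/H1 [YX ->]]; first by rewrite Xk eqxx.
  by rewrite orbT (subset_trans YX).
- move=> Y Z; rewrite !inE => /predU1P[->|YD] /predU1P[->|ZD].
  + by rewrite subxx.
  + by case: (H1 Z ZD) => ->; rewrite orbT.
  + by case: (H1 Y YD) => ->.
  + exact: H2.
- move=> j; rewrite inE => /predU1P[->|/H3 [Y YD Yj]]; first by exists X; rewrite ?setU11.
  by exists Y; rewrite // inE YD orbT.
Qed.

(** From the top down, each set of the chain is chosen inside the previous one. *)
Fixpoint flag_count (n : nat) s : nat :=
  if s is k :: s' then ('C(n, k) * flag_count k s')%N else 1%N.

Lemma card_chains U s : sorted gtn s -> #|chains U s| = flag_count #|U| s.
Proof.
elim: s U => [|k s IHs] U; first by rewrite chains_nil cards1.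
rewrite /= path_sortedE; last by move=> x y z; rewrite /= => yx xz; apply: ltn_trans xz yx.
case/andP => s_lt s_sorted.
(* The chains are sorted by their member of cardinality k; the default [set0] is not reached on
   [chains U (k :: s)]. *)
pose top (C : {set {set T}}) := odflt set0 [pick X in C | #|X| == k].
have topP C X : C \in chains U (k :: s) -> (top C == X) && (#|X| == k) && (X \subset U) = (X \in C) && (#|X| == k).
  move=> Cch; rewrite /top; case/chainsP: (Cch) => H1 _ H3.
  case: pickP => [Y /andP[YC /eqP Yk]|noY] /=.
    apply/andP/andP => [[/andP[/eqP<- ->] _]|[XC /eqP Xk]]; first by [].
    rewrite (chain_eq_card Cch YC XC) ?Yk ?Xk ?eqxx //.
    by case: (H1 X XC) => -> _.
  have [|Y YC Yk] := H3 k; first exact: mem_head.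
  by have := noY Y; rewrite YC Yk eqxx.
rewrite -[LHS]sum1_card.
rewrite (partition_big top [pred X : {set T} | (X \subset U) && (#|X| == k)]); last first.
  move=> C Cch; case/chainsP: (Cch) => H1 _ H3.
  have [|Y YC Yk] := H3 k; first exact: mem_head.
  have := topP C Y Cch; rewrite YC Yk eqxx /= => /andP[/andP[/eqP-> _] ->].
  by rewrite Yk eqxx.
rewrite /= (eq_bigr (fun=> flag_count k s)) => [|X /andP[XU /eqP Xk]].
  rewrite sum_nat_const -cards_draws; congr (_ * _)%N.
  by rewrite cardsE.
rewrite sum1_card -[in flag_count _ _]Xk -IHs //.
rewrite -[RHS](card_in_imset (f := fun C : {set {set T}} => X |: C)).
  rewrite -[[set X |: _ | _ in _]](chains_cons XU Xk s_lt); apply: eq_card => C; rewrite inE.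
  rewrite [in LHS]unfold_in /=; apply: andb_id2l => Cch.
  by have := topP C X Cch; rewrite Xk XU eqxx !andbT.
move=> C1 C2 C1ch C2ch eqC.
have XnotC D : D \in chains X s -> X \notin D.
  case/chainsP => H1 _ _; apply/negP => /H1 [_ Xs].
  by move/allP/(_ _ Xs): s_lt; rewrite /= Xk ltnn.
by rewrite -(setU1K (XnotC _ C1ch)) eqC setU1K // XnotC.
Qed.

End Chains.

(** * Flag numbers of the Boolean lattice *)

(** The predicate is indexed from 0, like the ordinals encoding rank sets, while the listed ranks
    start at 1; the order is decreasing, to suit [flag_count]. *)
Fixpoint rank_list (r : nat) (P : pred nat) : seq nat :=
  if r is r'.+1 then
    if P r' then r :: rank_list r' P else rank_list r' P
  else [::].

Lemma mem_rank_list r P k : (k \in rank_list r P) = [&& 0 < k, k <= r & P k.-1]%N.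
Proof.
elim: r => [|r IHr] /=; first by case: k.
have -> : (k \in if P r then r.+1 :: rank_list r P else rank_list r P)
        = (k == r.+1) && P r || (k \in rank_list r P).
  by case: (P r); rewrite ?inE ?andbT ?andbF.
rewrite IHr; case: k {IHr} => [|k] //=; rewrite eqSS ltnS.
by case: (ltngtP k r) => //= ->; rewrite orbF.
Qed.

Lemma sorted_rank_list r P : sorted gtn (rank_list r P).
Proof.
elim: r => //= r IHr; case: ifP => // _ /=.
rewrite path_sortedE; last by move=> x y z; rewrite /= => yx xz; apply: ltn_trans xz yx.
rewrite IHr andbT; apply/allP => k; rewrite mem_rank_list /= => /and3P[_ kr _].
by rewrite ltnS.
Qed.

Lemma eq_rank_list r P Q :
  (forall k, (k < r)%N -> P k = Q k) -> rank_list r P = rank_list r Q.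
Proof.
elim: r => //= r IHr eqPQ; rewrite IHr ?eqPQ // => k kr.
by apply: eqPQ; apply: ltnW.
Qed.

Definition ranks r (S : {set 'I_r}) : seq nat :=
  rank_list r (fun k => k \in [seq val i | i in S]).

Lemma mem_ranks r (S : {set 'I_r}) (i : 'I_r) : (i.+1 \in ranks S) = (i \in S).
Proof.
rewrite mem_rank_list /= ltn_ord /=.
by rewrite (mem_image val_inj).
Qed.

Lemma boolean_flag_f r (S : {set 'I_r}) :
  flag_f (boolean_grading r) S = flag_count r.+1 (ranks S).
Proof.
transitivity (flag_count #|[set: 'I_r.+1]| (ranks S)); last by rewrite cardsT card_ord.
rewrite -(card_chains _ (sorted_rank_list _ _)); apply: eq_card => C.
have properE (X : {set 'I_r.+1}) : (\bot < X < \top)%O = (0 < #|X| < r.+1)%N.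
  rewrite !lt_neqAle le0x lex1 !andbT card_gt0 eq_sym; congr andb.
  rewrite -[X == _]/(X == setT) eqEcard subsetT /= cardsT card_ord.
  by rewrite -ltnNge.
rewrite inE; apply/andP/chainsP.
  move=> [/andP[/forall_inP Cin /forall_inP Ccmp] /forallP Crk]; split.
  - move=> X XC; split; first exact: subsetT.
    have := Cin X XC; rewrite properE => /andP[X0 Xr].
    have Xr' : (#|X|.-1 < r)%N by rewrite prednK.
    have := mem_ranks S (Ordinal Xr'); rewrite /= prednK // => ->.
    rewrite (eqP (Crk (Ordinal Xr'))); apply/exists_inP; exists X => //=.
    by rewrite prednK // /bool_rank.
  - by move=> X Y XC YC; move/forall_inP/(_ Y YC): (Ccmp X XC).
  - move=> k kS; move: (kS); rewrite mem_rank_list => /and3P[k0 kr _].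
    have kr' : (k.-1 < r)%N by rewrite prednK.
    have := mem_ranks S (Ordinal kr'); rewrite /= prednK // kS => /esym.
    rewrite (eqP (Crk (Ordinal kr'))) => /exists_inP[X XC /eqP Xk].
    by exists X => //; rewrite -[LHS]/(boolean_grading r X) Xk /= prednK.
move=> [Cin Ccmp Crk]; split.
  apply/andP; split; last first.
    by apply/forall_inP => X XC; apply/forall_inP => Y YC; apply: Ccmp.
  apply/forall_inP => X /Cin [_]; rewrite mem_rank_list properE.
  by case/and3P => -> /=; rewrite ltnS.
apply/forallP => i; apply/eqP/(sameP idP)/(iffP exists_inP).
  move=> [X XC /eqP Xi]; rewrite -mem_ranks; case: (Cin X XC) => _.
  by rewrite -[#|X|]/(boolean_grading r X) Xi.
by rewrite -mem_ranks => /Crk [X XC Xi]; exists X => //; exact/eqP.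
Qed.

Lemma big_set_ord_recr (V : zmodType) r (F : {set 'I_r.+1} -> V) :
  let widen (x : bool) (S : {set 'I_r}) : {set 'I_r.+1} :=
    [set i | if unlift ord_max i is Some j then j \in S else x] in
  \sum_S F S = \sum_S (F (widen false S) + F (widen true S)).
Proof.
move=> widen; pose h (xS : bool * {set 'I_r}) := widen xS.1 xS.2.
pose g (S : {set 'I_r.+1}) := (ord_max \in S, [set j | lift ord_max j \in S]).
rewrite (reindex h) /=; last first.
  apply: onW_bij; exists g => [[x S]|S]; rewrite /h /g /widen /=.
    congr (_, _); first by rewrite inE unlift_none.
    by apply/setP => j; rewrite !inE liftK.
  apply/setP => i; rewrite inE; case: unliftP => [j ->|->] //.
  by rewrite inE.
rewrite -(pair_big xpredT xpredT (fun x S => F (widen x S))) /=.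
by rewrite big_bool /= addrC -big_split.
Qed.

(** * From flag numbers to the ab-index *)

Section FlagSum.
Variables (R : nzRingType) (b e : R).

(** The sum in [flag_sumE], unrolled at the largest rank, whose letter is the rightmost factor;
    [phi] absorbs the ranks already chosen. *)
Fixpoint flag_sum r (phi : seq nat -> nat) : R :=
  if r is r'.+1 then
    flag_sum r' phi * e + flag_sum r' (fun s => phi (r :: s)) * b
  else (phi [::])%:R.

Lemma flag_sumE r phi :
  \sum_(S : {set 'I_r}) (\prod_(i < r) if i \in S then b else e) *+ phi (ranks S)
    = flag_sum r phi.
Proof.
elim: r phi => [|r IHr] phi /=.
  rewrite (big_pred1 set0) ?big_ord0 // => S.
  by apply/esym/eqP/setP => -[].
rewrite big_set_ord_recr big_split /= -!IHr !mulr_suml.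
have ranksE (x : bool) (S : {set 'I_r}) :
    let W := [set i | if unlift ord_max i is Some j then j \in S else x] in
    ranks W = if x then r.+1 :: ranks S else ranks S.
  move=> W; rewrite /ranks /=.
  have -> : (r \in [seq val i | i in W]) = x.
    by rewrite -[r]/(val (ord_max : 'I_r.+1)) (mem_image val_inj) inE unlift_none.
  suff -> : rank_list r (fun k => k \in [seq val i | i in W])
          = rank_list r (fun k => k \in [seq val i | i in S]) by [].
  apply: eq_rank_list => k kr.
  rewrite -[k]/(val (Ordinal kr)) (mem_image val_inj).
  have -> : val (Ordinal kr) = val (lift ord_max (Ordinal kr)).
    by rewrite /= /bump leqNgt kr.
  by rewrite (mem_image val_inj) inE liftK.
have prodE (x : bool) (S : {set 'I_r}) :
    let W := [set i | if unlift ord_max i is Some j then j \in S else x] in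
    \prod_(i < r.+1) (if i \in W then b else e)
    = \prod_(i < r) (if i \in S then b else e) * (if x then b else e).
  move=> W; rewrite big_ord_recr /=; congr (_ * _).
    apply: eq_bigr => i _.
    have -> : widen_ord (leqnSn r) i = lift ord_max i.
      by apply: val_inj; rewrite /= /bump leqNgt ltn_ord.
    by rewrite inE liftK.
  by rewrite inE unlift_none.
by congr (_ + _); apply: eq_bigr => S _; rewrite ranksE prodE mulrnAl.
Qed.

Lemma flag_sumZ r n phi : flag_sum r (fun s => n * phi s)%N = flag_sum r phi *+ n.
Proof.
elim: r phi => [|r IHr] phi /=; first by rewrite mulnC natrM mulr_natr.
by rewrite IHr (IHr (fun s => phi (r.+1 :: s))) !mulrnAl -mulrnDl.
Qed.

(** The recursion of [pyramid_peel] on the side of chains: if k+1 is the largest chosen rank, the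
    ranks above it contribute powers of [e], and [flag_count] splits off the number of choices of
    the top set. *)
Lemma flag_sum_peel r n :
  flag_sum r (flag_count n) = e ^+ r
    + \sum_(k < r) flag_sum k (flag_count k.+1) * b * e ^+ (r - k.+1) *+ 'C(n, k.+1).
Proof.
elim: r => [|r IHr]; first by rewrite big_ord0 addr0.
rewrite big_ord_recr /= subnn expr0 mulr1 (flag_sumZ r 'C(n, r.+1) (flag_count r.+1)).
rewrite IHr mulrDl -exprSr mulr_suml -addrA mulrnAl; congr (_ + (_ + _)).
apply: eq_bigr => k _; rewrite mulrnAl -mulrA -exprSr subSS; congr (_ * _ ^+ _ *+ _).
by rewrite subnSK.
Qed.

End FlagSum.

(** Passing from flag h to flag f amounts to replacing a by a - b: the signs in h are those met when
    the factors a - b are multiplied out. *)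
Lemma sum_moebius (R : nzRingType) r (a b : R) (f : {set 'I_r} -> nat) :
  \sum_(S : {set 'I_r})
     (\prod_(i < r) if i \in S then b else a)
       *~ (\sum_(T : {set 'I_r} | T \subset S) (-1) ^+ #|S :\: T| * (f T)%:Z)
  = \sum_(T : {set 'I_r}) (\prod_(i < r) if i \in T then b else a - b) *+ f T.
Proof.
under eq_bigr => S _ do rewrite mulrz_sumr.
rewrite (exchange_big_dep xpredT) //=; apply: eq_bigr => T _.
(* [n i x] is the coefficient of the letter [u x] in the i-th factor, which is b for i in [T] and a
   - b otherwise. *)
pose n (i : 'I_r) (x : bool) : int :=
  if x then (if i \in T then 1 else -1) else (if i \in T then 0 else 1).
pose u (x : bool) := if x then b else a.
have prodMz (F : 'I_r -> R) (m : 'I_r -> int) :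
    \prod_i (F i *~ m i) = (\prod_i F i) *~ (\prod_i m i).
  elim/big_rec3: _ => [|i x y z _ ->]; first by rewrite mulr1z.
  by rewrite mulrzAl mulrzAr -mulrzA mulrC.
have -> : \prod_(i < r) (if i \in T then b else a - b)
        = \prod_(i < r) \sum_(x : bool) (u x *~ n i x).
  apply: eq_bigr => i _; rewrite big_bool /= /n /u.
  by case: ifP => _; rewrite ?mulr0z ?mulr1z ?addr0 // mulrN1z addrC.
rewrite bigA_distr_bigA /= (reindex (fun S : {set 'I_r} => [ffun i => i \in S])) /=; last first.
  exists (fun g : {ffun 'I_r -> bool} => [set i | g i]) => [S _|g _].
    by apply/setP => i; rewrite inE ffunE.
  by apply/ffunP => i; rewrite ffunE inE.
rewrite -sumrMnl big_mkcond /=; apply: eq_bigr => S _.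
rewrite [X in _ = X *+ _](eq_bigr (fun i => u (i \in S) *~ n i (i \in S))); last by move=> i _; rewrite ffunE.
rewrite prodMz; case: ifPn => [TS|/subsetPn[i iT iS]]; last first.
  rewrite [\prod_i n _ _](bigD1 i) //= /n (negbTE iS) iT mul0r mulr0z mul0rn //.
have -> : \prod_i n i (i \in S) = (-1) ^+ #|S :\: T|.
  rewrite -prodr_const [RHS]big_mkcond /=; apply: eq_bigr => i _; rewrite inE /n.
  case: (boolP (i \in T)) => [iT|_] /=; last by case: ifP.
  by rewrite (subsetP TS).
by rewrite mulrzA pmulrn.
Qed.

Lemma ab_index_boolean r :
  ab_index (boolean_grading r) = flag_sum var_b (var_a - var_b) r (flag_count r.+1).
Proof.
rewrite -flag_sumE; transitivity (\sum_(T : {set 'I_r})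
    (\prod_(i < r) if i \in T then var_b else var_a - var_b)
      *+ flag_f (boolean_grading r) T); last first.
  by apply: eq_bigr => S _; rewrite boolean_flag_f.
rewrite -sum_moebius; apply: eq_bigr => S _.
have scaleMz (x : int) (p : ab_poly) : x *: p = p *~ x by rewrite -scaler_int intz.
exact: scaleMz.
Qed.

Lemma peel_unique (R : nzRingType) (b e : R) (X Y : nat -> R) :
  (forall r, X r = e ^+ r
     + \sum_(k < r) X k * b * e ^+ (r - k.+1) *+ 'C(r.+1, k.+1)) ->
  (forall r, Y r = e ^+ r
     + \sum_(k < r) Y k * b * e ^+ (r - k.+1) *+ 'C(r.+1, k.+1)) ->
  X =1 Y.
Proof.
move=> XE YE; elim/ltn_ind => r IHr; rewrite XE YE; congr (_ + _).
by apply: eq_bigr => k _; rewrite IHr.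
Qed.

Lemma cd_index_boolean r : cd_index (boolean_grading r) = boolean_cd r.
Proof.
apply: cd_index_eq; rewrite ab_index_boolean.
apply: (peel_unique (X := fun r => cd_expand (boolean_cd r))
   (Y := fun r => flag_sum var_b (var_a - var_b) r (flag_count r.+1))) => k.
  exact: cd_expand_boolean_peel.
exact: flag_sum_peel.
Qed.

Lemma beta_wordE w : beta_word (FMonom w) = coef (boolean_cd (cd_degree (FMonom w))) w.
Proof. by rewrite /beta_word cd_index_boolean coef.unlock. Qed.

(** * The reduction recursion *)

Implicit Types (P Q : seq nat).

Definition cd_list_word P : seq bool :=
  if P is k :: s then list_word k s else [::].

(** Every entry is charged for one d, one more than the word contains, which makes the weight
    additive under concatenation. *)
Definition list_weight P : nat := sumn [seq k.+2 | k <- P].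

(** [down_words] in terms of lists: a merge undoes c -> d, the decrement of an entry before a d
    undoes d -> cd, and that of the last entry drops a final c. *)
Fixpoint reductions P : seq (seq nat) :=
  if P is k :: s then
    (if k is k'.+1 then [:: k' :: s] else [::])
    ++ (if s is l :: s' then [:: (k + l).+1 :: s'] else [::])
    ++ [seq k :: Q | Q <- reductions s]
  else [::].

Lemma reductions_neq0 P Q : Q \in reductions P -> Q != [::].
Proof.
case: P => //= k s; rewrite !mem_cat => /or3P[].
- by case: k => //= k; rewrite inE => /eqP ->.
- by case: s => //= l s; rewrite inE => /eqP ->.
- by case/mapP => R _ ->.
Qed.

Lemma reductions_weight P Q : Q \in reductions P -> (list_weight Q).+1 = list_weight P.
Proof.
elim: P Q => //= k s IHs Q; rewrite !mem_cat => /or3P[].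
- by case: k => //= k; rewrite inE => /eqP ->.
- case: s {IHs} => //= l s; rewrite inE => /eqP ->.
  by rewrite /list_weight /=; lia.
- by case/mapP => R /IHs; rewrite /list_weight => RE -> /=; rewrite -RE; lia.
Qed.

Lemma cd_degree_word P : P != [::] ->
  (cd_degree (FMonom (cd_list_word P))).+2 = list_weight P.
Proof.
case: P => //= k s _; rewrite /cd_degree /list_weight /=.
have nseqE j : (\sum_(l <- nseq j false) (if l then 2 else 1) = j)%N.
  by elim: j => [|j IHj]; rewrite /= (big_nil, big_cons) // IHj add1n.
rewrite big_cat nseqE !addSn /=; congr (_ + _).+2.
elim: s => [|l s IHs] /=; first by rewrite big_nil.
by rewrite big_cons big_cat /= nseqE IHs /=; lia.
Qed.

Lemma down_words_list P :
  P != [::] -> down_words (cd_list_word P) = [seq cd_list_word Q | Q <- reductions P].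
Proof.
elim: P => // k s IHs _.
elim: k => [|k IHk] /=.
  case: s IHs => [|l s] // /(_ isT) IHs.
  rewrite -[flatten _]/(true :: cd_list_word (l :: s)) [LHS]/= IHs map_cat.
  congr (_ :: _); rewrite -!map_comp.
  by apply/eq_in_map => -[|j Q] /reductions_neq0.
rewrite -[nseq k false ++ _]/(cd_list_word (k :: s)) IHk /=.
case: k {IHk} => [|k] /=; rewrite ?map_cat /= -!map_comp.
  by case: s IHs => [|l s].
by case: s IHs => [|l s].
Qed.

Definition beta_list P : int :=
  if P is k :: s then beta_word (list_word k s) else 0.

Lemma beta_ints P : beta (ints P) = beta_list P.
Proof.
rewrite /beta /ints.
have -> : all (fun x : int => 0 <= x) [seq n%:Z | n <- P] by apply/allP => x /mapP[n _ ->].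
by rewrite -map_comp /= map_id_in.
Qed.

Lemma beta_list_rec P : P != [::] -> P != [:: 0%N] ->
  beta_list P = \sum_(Q <- reductions P) beta_list Q.
Proof.
move=> P0 P1.
have bE Q : Q != [::] ->
    beta_list Q = coef (boolean_cd (list_weight Q).-2) (cd_list_word Q).
  move=> Q0; rewrite -cd_degree_word //=.
  by case: Q Q0 => // k s _; rewrite -beta_wordE.
have : (2 < list_weight P)%N.
  by case: P P0 P1 {bE} => // -[|k] [|l s] // _ _; rewrite /list_weight /=; lia.
rewrite bE //; case PE: (list_weight P) => [|[|[|n]]] //= _.
rewrite coef_cd_up down_words_list // big_map.
rewrite [LHS]big_seq [RHS]big_seq; apply: eq_bigr => Q QP.
rewrite bE ?(reductions_neq0 QP) //.
by have := reductions_weight QP; rewrite PE => -[->].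
Qed.

(* The list_weight of P is the degree of its word plus 2. *)
Definition bt P : rat := (beta_list P)%:~R / ((list_weight P).-1)`!%:R.

Lemma bt0 : bt [:: 0%N] = 1.
Proof.
rewrite /bt /list_weight /= /list_word /= beta_wordE /cd_degree big_nil.
by rewrite /boolean_cd /= -wd_nil coef_wd eqxx divr1.
Qed.

Lemma bt_rec P : P != [::] -> P != [:: 0%N] ->
  ((list_weight P)%:R - 1) * bt P = \sum_(Q <- reductions P) bt Q.
Proof.
move=> P0 P1.
have : (2 < list_weight P)%N.
  by case: P P0 P1 => // -[|k] [|l s] // _ _; rewrite /list_weight /=; lia.
case PE: (list_weight P) => [|[|[|n]]] //= _.
rewrite /bt PE beta_list_rec // rmorph_sum /= mulr_suml mulr_sumr.
rewrite [LHS]big_seq [RHS]big_seq; apply: eq_bigr => Q QP.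
have [QE] : (list_weight Q).+1 = n.+3 by rewrite (reductions_weight QP).
have -> : n.+3%:R - 1 = n.+2%:R :> rat by rewrite -natr1 addrK.
by rewrite QE [in LHS]factS natrM invfM mulrCA mulVKf // pnatr_eq0.
Qed.

(** * The product identity *)

Implicit Types (A B L M N Z : seq nat) (a b i j k m n x y : nat).

Lemma list_weight_cat A B : list_weight (A ++ B) = (list_weight A + list_weight B)%N.
Proof. by rewrite /list_weight map_cat sumn_cat. Qed.

Lemma list_weight_nil : list_weight [::] = 0%N.
Proof. by []. Qed.

Lemma list_weight_cons x B : list_weight (x :: B) = (x.+2 + list_weight B)%N.
Proof. by []. Qed.

Lemma list_weight_rev A : list_weight (rev A) = list_weight A.
Proof. by rewrite /list_weight map_rev sumn_rev. Qed.

Definition red (f : seq nat -> rat) P : rat := \sum_(Q <- reductions P) f Q.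

(** The value 0 at [x = 0] is the convention for lists with a negative entry. *)
Definition dec (g : nat -> rat) x : rat := if x is x'.+1 then g x' else 0.

Definition merge_left A (g : seq nat -> nat -> rat) x : rat :=
  if A is k :: s then g (belast k s) (last k s + x).+1 else 0.

Definition merge_right B (g : seq nat -> nat -> rat) x : rat :=
  if B is k :: s then g s (x + k).+1 else 0.

(** The reductions of [A] followed by [x] that touch [A], the merge with [x] included. [g] receives
    the list before the entry and the entry itself, so that anything may follow. *)
Definition red_left A g x : rat := red (g^~ x) A + merge_left A g x.

Definition red_right B g x : rat := red (g^~ x) B + merge_right B g x.

Lemma merge_left_rcons A k g x : merge_left (rcons A k) g x = g A (k + x).+1.
Proof. by case: A => //= l s; rewrite belast_rcons last_rcons. Qed.

Lemma eq_red f g P : f =1 g -> red f P = red g P.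
Proof. by move=> eqfg; apply: eq_bigr. Qed.

Lemma red_cons f x B :
  red f (x :: B) = dec (fun y => f (y :: B)) x
                   + red_right B (fun Q y => f (y :: Q)) x.
Proof.
rewrite /red_right /red /= big_cat big_cat big_map /=.
case: x => [|x]; case: B => [|k s]; rewrite ?big_seq1 ?big_nil /=; ring.
Qed.

Lemma red_cat f A x B :
  red f (A ++ x :: B) = red_left A (fun Q y => f (Q ++ y :: B)) x
                        + dec (fun y => f (A ++ y :: B)) x
                        + red_right B (fun Q y => f (A ++ y :: Q)) x.
Proof.
elim: A f => [|k A IHA] f /=.
  by rewrite /red_left /= /red big_nil !add0r -/(red _ _) red_cons.
rewrite red_cons {1}/red_right -/cat IHA {2}/red_left red_cons /red_right.
rewrite /merge_left /merge_right /red_left; case: A {IHA} => [|l A] /=.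
  by rewrite /red /= !big_nil; ring.
by rewrite /merge_left /=; ring.
Qed.

Lemma red_cat2 f A x y B :
  red f (A ++ x :: y :: B) =
    red_left A (fun Q z => f (Q ++ z :: y :: B)) x
    + dec (fun z => f (A ++ z :: y :: B)) x
    + f (A ++ (x + y).+1 :: B)
    + dec (fun z => f (A ++ x :: z :: B)) y
    + red_right B (fun Q z => f (A ++ x :: z :: Q)) y.
Proof.
by rewrite red_cat [red_right (y :: B) _ _]/red_right /= red_cons; ring.
Qed.

Lemma red_rev f P : red f (rev P) = red (f \o rev) P.
Proof.
elim: P f => [|k s IHs] f; first by rewrite /red !big_nil.
rewrite rev_cons -cats1 red_cat [red_right [::] _ _]/red_right [red _ [::]]big_nil /= !addr0.
rewrite red_cons addrC; congr (_ + _).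
  by case: k => //= k; rewrite rev_cons -cats1.
rewrite /red_left /red_right IHs; congr (_ + _).
  by apply: eq_red => Q; rewrite /= rev_cons -cats1.
case: s {IHs} => [|l s] //=; rewrite rev_cons.
by rewrite merge_left_rcons addnC rev_cons -cats1.
Qed.

Lemma bt_recE P : P != [::] ->
  ((list_weight P)%:R - 1) * bt P = red bt P + (P == [:: 0%N])%:R.
Proof.
move=> P0; have [->|P1] := eqVneq P [:: 0%N]; last by rewrite bt_rec ?addr0.
by rewrite bt0 /red big_nil /list_weight /=; ring.
Qed.

Lemma bt_nil : bt [::] = 0.
Proof. by rewrite /bt mul0r. Qed.

Lemma bt_gt0 P : P != [::] -> 0 < bt P.
Proof.
have [n] := ubnP (list_weight P); elim: n P => // n IHn P Pn P0.
have [->|P1] := eqVneq P [:: 0%N]; first by rewrite bt0.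
have w0 : 0 < (list_weight P)%:R - 1 :> rat.
  by rewrite subr_gt0 ltr1n; case: P P0 {Pn P1} => // k s _; rewrite /list_weight /=; lia.
rewrite -(pmulr_rgt0 _ w0) bt_rec //.
have: reductions P != [::] by case: P P0 P1 {Pn w0} => // -[|k] [|l s].
have: forall Q, Q \in reductions P -> 0 < bt Q.
  move=> Q QP; apply: IHn (reductions_neq0 QP).
  by rewrite -(reductions_weight QP) ltnS in Pn.
case: (reductions P) => // Q s bt_pos _; rewrite big_cons.
rewrite ltr_pwDl ?bt_pos ?mem_head // big_seq sumr_ge0 // => R Rs.
by rewrite ltW // bt_pos // inE Rs orbT.
Qed.

Lemma bt_ge0 P : 0 <= bt P.
Proof. by case: P => [|k s]; [rewrite bt_nil | rewrite ltW // bt_gt0]. Qed.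

Lemma bt_rev P : bt (rev P) = bt P.
Proof.
have [n] := ubnP (list_weight P); elim: n P => // n IHn P Pn.
have [->|P0] := eqVneq P [::]; first by [].
have w0 : (list_weight P)%:R - 1 != 0 :> rat.
  rewrite subr_eq0 pnatr_eq1.
  by case: P P0 {Pn} => // k s _; rewrite /list_weight /=; lia.
apply: (mulfI w0); rewrite bt_recE // -{1}list_weight_rev bt_recE; last first.
  by rewrite -size_eq0 size_rev size_eq0.
rewrite red_rev; congr (_ + _%:R); last first.
  by rewrite -[[:: 0%N]]/(rev [:: 0%N]) (inj_eq (can_inj revK)).
rewrite /red big_seq [RHS]big_seq; apply: eq_bigr => Q QP; apply: IHn.
by rewrite -(reductions_weight QP) ltnS in Pn.
Qed.

Definition split_sum A a b B : rat :=
  dec (fun z => bt (A ++ z :: b :: B)) a + dec (fun z => bt (A ++ a :: z :: B)) b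
  + 2 * bt (A ++ (a + b).+1 :: B).

Lemma red_leftD A g h x :
  red_left A (fun Q y => g Q y + h Q y) x = red_left A g x + red_left A h x.
Proof.
rewrite /red_left /merge_left /red big_split /=.
by case: A => [|k A]; ring.
Qed.

Lemma red_leftZ A c g x :
  red_left A (fun Q y => c * g Q y) x = c * red_left A g x.
Proof.
rewrite /red_left /merge_left /red -mulr_sumr.
by case: A => [|k A]; ring.
Qed.

(** For [x = 0] one term survives: merging [x] with the last entry k of [A] gives k + 1, which can
    be decremented. *)
Lemma red_left_dec A g x :
  red_left A (fun Q => dec (g Q)) x = dec (red_left A g) x
    + (if x is 0 then if A is k :: s then g (belast k s) (last k s) else 0 else 0).
Proof.
rewrite /red_left /merge_left; case: x => [|x] /=.
  rewrite /red big1 // add0r add0r; case: A => // k s.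
  by rewrite addn0.
rewrite addr0; congr (_ + _); case: A => // k s.
by rewrite addnS.
Qed.

Lemma red_rightD B g h x :
  red_right B (fun Q y => g Q y + h Q y) x = red_right B g x + red_right B h x.
Proof.
rewrite /red_right /merge_right /red big_split /=.
by case: B => [|k B]; ring.
Qed.

Lemma red_rightZ B c g x :
  red_right B (fun Q y => c * g Q y) x = c * red_right B g x.
Proof.
rewrite /red_right /merge_right /red -mulr_sumr.
by case: B => [|k B]; ring.
Qed.

Lemma red_right_dec B g x :
  red_right B (fun Q => dec (g Q)) x = dec (red_right B g) x
    + (if x is 0 then if B is k :: s then g s k else 0 else 0).
Proof.
rewrite /red_right /merge_right; case: x => [|x] /=.
  by rewrite /red big1 // add0r add0r; case: B.
by rewrite addr0; congr (_ + _); case: B.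
Qed.

Lemma red_left_split A a b B :
  red_left A (fun Q x => split_sum Q x b B) a =
    dec (red_left A (fun Q z => bt (Q ++ z :: b :: B))) a
    + dec (fun y => red_left A (fun Q z => bt (Q ++ z :: y :: B)) a) b
    + 2 * red_left A (fun Q z => bt (Q ++ z :: B)) (a + b).+1
    + (if a is 0 then if A is [::] then 0 else bt (A ++ b :: B) else 0).
Proof.
rewrite /split_sum !red_leftD red_leftZ red_left_dec.
have -> : red_left A (fun Q y => bt (Q ++ (y + b).+1 :: B)) a =
          red_left A (fun Q z => bt (Q ++ z :: B)) (a + b).+1.
  rewrite /red_left /merge_left; congr (_ + _); case: A => // k s.
  by rewrite addSn addnS addnA.
have -> : red_left A (fun Q y => dec (fun z => bt (Q ++ y :: z :: B)) b) a =
          dec (fun y => red_left A (fun Q z => bt (Q ++ z :: y :: B)) a) b.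
  case: b => //=; rewrite /red_left /merge_left /red big1 // add0r.
  by case: A.
have -> : (if A is k :: s then bt (belast k s ++ last k s :: b :: B) else 0) =
          (if A is [::] then 0 else bt (A ++ b :: B)).
  by case: A => // k s; rewrite -cat_rcons -lastI.
by rewrite [LHS](ACl (1*3*4*2))%AC; case: a.
Qed.

Lemma red_right_split A a b B :
  red_right B (fun Q y => split_sum A a y Q) b =
    dec (fun x => red_right B (fun Q z => bt (A ++ x :: z :: Q)) b) a
    + dec (red_right B (fun Q z => bt (A ++ a :: z :: Q))) b
    + 2 * red_right B (fun Q z => bt (A ++ z :: Q)) (a + b).+1
    + (if b is 0 then if B is [::] then 0 else bt (A ++ a :: B) else 0).
Proof.
rewrite /split_sum !red_rightD red_rightZ red_right_dec.
have -> : red_right B (fun Q y => bt (A ++ (a + y).+1 :: Q)) b =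
          red_right B (fun Q z => bt (A ++ z :: Q)) (a + b).+1.
  rewrite /red_right /merge_right; congr (_ + _); case: B => // k s.
  by rewrite addSn addnS addnA.
have -> : red_right B (fun Q y => dec (fun z => bt (A ++ z :: y :: Q)) a) b =
          dec (fun x => red_right B (fun Q z => bt (A ++ x :: z :: Q)) b) a.
  case: a => //=; rewrite /red_right /merge_right /red big1 // add0r.
  by case: B.
have -> : (if B is k :: s then bt (A ++ a :: k :: s) else 0) =
          (if B is [::] then 0 else bt (A ++ a :: B)).
  by case: B.
by rewrite addrA [LHS](ACl (1*2*4*3))%AC; case: b.
Qed.

(* Multiplication by the weight turns both sides into sums over reductions, and
   the reductions of the two sides match. *)
Lemma bt_mul A a b B : bt (A ++ [:: a]) * bt (b :: B) = split_sum A a b B.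
Proof.
have [n] := ubnP (list_weight A + a + b + list_weight B)%N.
elim: n A a b B => // n IHn A a b B le_n.
(* [W] is degree + 1 for each list on the right, and the sum of these numbers for the two factors on
   the left. *)
pose W : rat := (list_weight A + a + b + list_weight B)%:R + 2.
have W0 : W != 0 by rewrite /W -natrD pnatr_eq0 addn2.
apply: (mulfI W0).
have redA : red_left A (fun Q x => bt (Q ++ [:: x]) * bt (b :: B)) a =
            red_left A (fun Q x => split_sum Q x b B) a.
  rewrite /red_left; congr (_ + _).
    rewrite /red big_seq [RHS]big_seq; apply: eq_bigr => Q QA; apply: IHn.
    by rewrite -(reductions_weight QA) in le_n; lia.
  case/lastP: A le_n {W W0} => // A k le_n; rewrite !merge_left_rcons; apply: IHn.
  by move: le_n; rewrite -cats1 list_weight_cat list_weight_cons /=; lia.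
have redB : red_right B (fun Q y => bt (A ++ [:: a]) * bt (y :: Q)) b =
            red_right B (fun Q y => split_sum A a y Q) b.
  rewrite /red_right; congr (_ + _).
    rewrite /red big_seq [RHS]big_seq; apply: eq_bigr => Q QB; apply: IHn.
    by rewrite -(reductions_weight QB) in le_n; lia.
  case: B le_n {W W0 redA} => // k B le_n; apply: IHn.
  by move: le_n; rewrite list_weight_cons; lia.
have decA : dec (fun x => bt (A ++ [:: x]) * bt (b :: B)) a =
            dec (fun x => split_sum A x b B) a.
  by case: a le_n {W W0 redA redB} => //= a le_n; apply: IHn; lia.
have decB : dec (fun y => bt (A ++ [:: a]) * bt (y :: B)) b =
            dec (fun y => split_sum A a y B) b.
  by case: b le_n {W W0 redA redB decA} => //= b le_n; apply: IHn; lia.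
have eqW P : P != [::] -> P != [:: 0%N] ->
    list_weight P = (list_weight A + a + b + list_weight B).+3 -> W * bt P = red bt P.
  move=> P0 P1 PW; rewrite -[RHS]addr0 -[X in _ + X](_ : (P == [:: 0%N])%:R = 0).
    by rewrite -bt_recE // PW /W -addn3 natrD; congr (_ * _); ring.
  by rewrite (negbTE P1).
(* The corner terms at the end of each line come from the list [[:: 0]], where the recursion has an
   extra summand 1. *)
have ZE : W * (bt (A ++ [:: a]) * bt (b :: B)) =
    red_left A (fun Q x => split_sum Q x b B) a + dec (fun x => split_sum A x b B) a
    + (if a is 0 then if A is [::] then bt (b :: B) else 0 else 0)
    + (red_right B (fun Q y => split_sum A a y Q) b + dec (fun y => split_sum A a y B) b
    + (if b is 0 then if B is [::] then bt (A ++ [:: a]) else 0 else 0)).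
  have -> : W = ((list_weight (A ++ [:: a]))%:R - 1) + ((list_weight (b :: B))%:R - 1).
    rewrite list_weight_cat !list_weight_cons /W !natrD.
    by rewrite -[a.+2]addn2 -[b.+2]addn2 !natrD /list_weight /=; ring.
  rewrite mulrDl mulrA bt_recE ?size_cat -?size_eq0 ?size_cat ?addn1 //.
  rewrite [_ * (bt _ * bt _)]mulrCA bt_recE // red_cat red_cons.
  rewrite -redA -redB -decA -decB.
  have redlM (g : seq nat -> nat -> rat) c :
      red_left A (fun Q x => g Q x * c) a = red_left A g a * c.
    by rewrite /red_left /merge_left /red -mulr_suml; case: (A) => [|k s]; ring.
  have redrM (g : seq nat -> nat -> rat) c :
      red_right B (fun Q y => c * g Q y) b = c * red_right B g b.
    exact: red_rightZ.
  have decl (g : nat -> rat) c y : dec (fun x => g x * c) y = dec g y * c.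
    by case: y => //=; rewrite mul0r.
  have decr (g : nat -> rat) c y : dec (fun x => c * g x) y = c * dec g y.
    by case: y => //=; rewrite mulr0.
  have dA : (A ++ [:: a] == [:: 0%N])%:R * bt (b :: B) =
      (if a is 0 then if A is [::] then bt (b :: B) else 0 else 0).
    by case: (A) => [|k [|l s]]; case: (a) => [|a'];
       rewrite /= ?eqseq_cons /= ?andbF ?mul0r ?mul1r.
  have dB : bt (A ++ [:: a]) * (b :: B == [:: 0%N])%:R =
      (if b is 0 then if B is [::] then bt (A ++ [:: a]) else 0 else 0).
    by case: (B) => [|k s]; case: (b) => [|b'];
       rewrite /= ?eqseq_cons /= ?andbF ?mulr0 ?mulr1.
  rewrite redlM redrM decl decr -dA -dB.
  have -> : red_right [::] (fun Q y => bt (A ++ y :: Q)) a = 0.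
    by rewrite /red_right /red big_nil addr0.
  ring.
rewrite ZE red_left_split red_right_split /split_sum.
rewrite [W * _]mulrDr [W * (dec _ _ + _)]mulrDr [W * (2 * _)]mulrCA [W * bt _]eqW; last first.
- by rewrite list_weight_cat list_weight_cons; lia.
- by apply/eqP; case: (A) => [|k [|l s]].
- by case: (A).
rewrite red_cat.
have WA : W * dec (fun z => bt (A ++ z :: b :: B)) a =
    dec (fun z => red bt (A ++ z :: b :: B)) a.
  case: (a) eqW => [|a'] eqW /=; first by rewrite mulr0.
  apply: eqW; [by case: (A)|by apply/eqP; case: (A) => [|k [|l s]]|].
  by rewrite list_weight_cat !list_weight_cons; lia.
have WB : W * dec (fun z => bt (A ++ a :: z :: B)) b =
    dec (fun z => red bt (A ++ a :: z :: B)) b.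
  case: (b) eqW => [|b'] eqW /=; first by rewrite mulr0.
  apply: eqW; [by case: (A)|by apply/eqP; case: (A) => [|k [|l s]]|].
  by rewrite list_weight_cat !list_weight_cons; lia.
(* For [a = 0] the corner terms of [ZE] and of [red_left_split] complement each other: they add up
   to [bt (A ++ b :: B)] whether [A] is empty or not. The case [b = 0] is symmetric. *)
have mA : (if A is [::] then bt (b :: B) else 0)
    = bt (A ++ b :: B) - (if A is [::] then 0 else bt (A ++ b :: B)).
  by case: (A) => [|k s]; rewrite ?subr0 ?subrr.
have mB : (if B is [::] then bt (A ++ [:: a]) else 0)
    = bt (A ++ a :: B) - (if B is [::] then 0 else bt (A ++ a :: B)).
  by case: (B) => [|k s]; rewrite ?subr0 ?subrr.
rewrite {}WA {}WB {}mA {}mB {ZE eqW redA redB decA decB IHn le_n W W0}.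
have [mA ->] : {x : rat | (if A is [::] then 0 else bt (A ++ b :: B)) = x} by eexists.
have [mB ->] : {x : rat | (if B is [::] then 0 else bt (A ++ a :: B)) = x} by eexists.
case: a => [|a']; case: b => [|b'] /=;
  rewrite ?red_cat2 /= ?(addSn, addnS, add0n, addn0); ring.
Qed.

(** * Cuts *)

(* Each reduction of A taken twice, except the decrement of the last entry,
   taken once. *)
Fixpoint half_left A : seq (seq nat) :=
  if A is k :: s then
    let decs := if k is k'.+1 then [:: k' :: s] else [::] in
    if s is l :: s' then
      decs ++ decs ++ [:: (k + l).+1 :: s'; (k + l).+1 :: s']
        ++ [seq k :: Q | Q <- half_left s]
    else decs
  else [::].

Definition half_right B : seq (seq nat) := [seq rev Q | Q <- half_left (rev B)].

Lemma half_left_red A Q : Q \in half_left A -> Q \in reductions A.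
Proof.
elim: A Q => //= k [|l s] IHs Q; first by rewrite /= !cats0; case: k.
rewrite !mem_cat !inE; case: (Q \in _) => //=; case: (Q == _) => //=.
by case/mapP => R Rs ->; rewrite (map_f (cons k) (IHs _ Rs)).
Qed.

Lemma half_left_weight A Q : Q \in half_left A -> (list_weight Q < list_weight A)%N.
Proof. by move/half_left_red/reductions_weight => <-. Qed.

Lemma half_right_weight B Q : Q \in half_right B -> (list_weight Q < list_weight B)%N.
Proof.
by case/mapP => R /half_left_weight; rewrite list_weight_rev => H ->; rewrite list_weight_rev.
Qed.

Lemma sum_half_left_cat (g : seq nat -> rat) A x :
  \sum_(Q <- half_left (A ++ [:: x])) g Q
    = 2 * red_left A (fun Q y => g (Q ++ [:: y])) x + dec (fun y => g (A ++ [:: y])) x.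
Proof.
elim: A g => [|k A IHA] g /=.
  rewrite /red_left /red big_nil /=.
  by case: x => [|x]; rewrite ?big_nil ?big_seq1 /=; ring.
have -> : red_left (k :: A) (fun Q y => g (Q ++ [:: y])) x =
  dec (fun z => g (z :: A ++ [:: x])) k
  + (if A ++ [:: x] is l :: s then g ((k + l).+1 :: s) else 0)
  + red_left A (fun Q y => g (k :: Q ++ [:: y])) x.
  rewrite /red_left red_cons /red_right /merge_right /merge_left.
  case: A {IHA} => [|l A] /=; last by ring.
  by rewrite /red !big_nil; ring.
case: A IHA => [|l A] IHA /=; rewrite !big_cat !big_cons ?big_nil big_map /=.
  rewrite (IHA (fun Q => g (k :: Q))) /=.
  by case: k => [|k]; rewrite ?big_nil ?big_seq1 /=; ring.
rewrite (IHA (fun Q => g (k :: Q))) /=.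
by case: k => [|k]; rewrite ?big_nil ?big_seq1 /=; ring.
Qed.

Lemma sum_half_left_cat2 (g : seq nat -> rat) A x l L :
  \sum_(Q <- half_left (A ++ x :: l :: L)) g Q
    = 2 * red_left A (fun Q y => g (Q ++ y :: l :: L)) x
      + 2 * dec (fun y => g (A ++ y :: l :: L)) x
      + 2 * g (A ++ (x + l).+1 :: L)
      + \sum_(Q <- half_left (l :: L)) g (A ++ x :: Q).
Proof.
elim: A g => [|k A IHA] g.
  rewrite /red_left /red /= !big_cat !big_cons ?big_nil big_map /=.
  by case: x => [|x]; rewrite ?big_nil ?big_seq1 /=; ring.
have -> : red_left (k :: A) (fun Q y => g (Q ++ y :: l :: L)) x =
  dec (fun z => g (z :: A ++ x :: l :: L)) k
  + (if A ++ x :: l :: L is j :: s then g ((k + j).+1 :: s) else 0)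
  + red_left A (fun Q y => g (k :: Q ++ y :: l :: L)) x.
  rewrite /red_left red_cons /red_right /merge_right /merge_left.
  case: A {IHA} => [|j A] /=; last by ring.
  by rewrite /red !big_nil; ring.
case: A IHA => [|j A] IHA; rewrite [half_left _]/= !big_cat !big_cons ?big_nil big_map /=;
  rewrite (IHA (fun Q => g (k :: Q))) /=;
  by case: k => [|k]; rewrite ?big_nil ?big_seq1 /=; ring.
Qed.

(* What bt_mul makes of the merge across a cut; at an end of the list there is no
   merge, and the unused half of the decrement remains. *)
Definition cut_left A x B : rat :=
  if A is [::] then dec (fun y => bt (y :: B)) x else bt A * bt (x :: B).

Definition cut_right A x B : rat :=
  if B is [::] then dec (fun y => bt (A ++ [:: y])) x else bt (A ++ [:: x]) * bt B.

(** If [A] ends in k, [bt_mul] at the cut between k and [x] replaces twice their merge by the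
    product minus the decrements of k and of [x]. Of the two decrements of k one is left, as in
    [half_left]. *)
Lemma red_left_cut A x B :
  2 * red_left A (fun Q y => bt (Q ++ y :: B)) x + dec (fun y => bt (A ++ y :: B)) x
    = \sum_(Q <- half_left A) bt (Q ++ x :: B) + cut_left A x B.
Proof.
case/lastP: A => [|A k].
  by rewrite /red_left /red !big_nil /cut_left /=; ring.
have -> : cut_left (rcons A k) x B = bt (A ++ [:: k]) * bt (x :: B).
  by rewrite cats1; case: (A).
rewrite bt_mul /split_sum -cats1 sum_half_left_cat cats1.
rewrite [red_left (rcons A k) _ _]/red_left merge_left_rcons -cats1 red_cat.
have -> : red_right [::] (fun Q y => bt ((A ++ y :: Q) ++ x :: B)) k = 0.
  by rewrite /red_right /red big_nil addr0.
have -> : dec (fun y => bt ((A ++ [:: y]) ++ x :: B)) k =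
          dec (fun y => bt (A ++ [:: y, x & B])) k.
  by case: k => //= k; rewrite -catA.
have -> : dec (fun y => bt ((A ++ [:: k]) ++ y :: B)) x =
          dec (fun y => bt (A ++ [:: k, y & B])) x.
  by case: x => //= x; rewrite -catA.
ring.
Qed.

Lemma bt_rev_cat A y B : bt (rev B ++ y :: rev A) = bt (A ++ y :: B).
Proof. by rewrite -cat_rcons -rev_cons -rev_cat bt_rev. Qed.

Lemma red_right_cut A x B :
  2 * red_right B (fun Q y => bt (A ++ y :: Q)) x + dec (fun y => bt (A ++ y :: B)) x
    = \sum_(Q <- half_right B) bt (A ++ x :: Q) + cut_right A x B.
Proof.
have := red_left_cut (rev B) x (rev A).
have -> : red_left (rev B) (fun Q y => bt (Q ++ y :: rev A)) x
        = red_right B (fun Q y => bt (A ++ y :: Q)) x.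
  rewrite /red_left /red_right red_rev; congr (_ + _).
    by apply: eq_red => Q /=; rewrite bt_rev_cat.
  by case: B => //= l B; rewrite rev_cons merge_left_rcons addnC bt_rev_cat.
have -> : dec (fun y => bt (rev B ++ y :: rev A)) x = dec (fun y => bt (A ++ y :: B)) x.
  by case: x => //= x; rewrite bt_rev_cat.
have -> : cut_left (rev B) x (rev A) = cut_right A x B.
  rewrite /cut_left /cut_right; case/lastP: B => [|B k].
    by case: x => //= x; rewrite -(bt_rev_cat A x [::]).
  rewrite rev_rcons -rev_rcons bt_rev mulrC -(bt_rev_cat A x [::]) /=.
  by case: B.
move=> ->; congr (_ + _); rewrite big_map; apply: eq_bigr => Q _.
by rewrite -bt_rev_cat revK.
Qed.

(** In twice the recursion, each side of [x] receives one copy of the decrement of [x]. *)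
Lemma bt_cut A x B : A ++ x :: B != [:: 0%N] ->
  2 * ((list_weight (A ++ x :: B))%:R - 1) * bt (A ++ x :: B) =
    \sum_(Q <- half_left A) bt (Q ++ x :: B) + cut_left A x B
    + cut_right A x B + \sum_(Q <- half_right B) bt (A ++ x :: Q).
Proof.
move=> P1; rewrite -mulrA bt_rec //; last by case: A {P1}.
rewrite -/(red _ _) red_cat.
by have := red_left_cut A x B; have := red_right_cut A x B; lra.
Qed.

(** What a cut before [y] leaves between [x] and [y], once one decrement of [x] is spent on a
    further cut before [x]. For empty [L] the entry [x] is last before the cut and has only that one
    copy. *)
Definition inner_cut A x L y B : rat :=
  if L is l :: s then
    dec (fun z => bt (A ++ z :: L ++ y :: B)) x
    + 2 * bt (A ++ (x + l).+1 :: s ++ y :: B)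
    + \sum_(Q <- half_left L) bt (A ++ x :: Q ++ y :: B)
  else 0.

(** The cuts at both sides of [y] come from [bt_cut]; the half sum to the left of [y] is then cut
    before [x] by [red_left_cut]. *)
Lemma bt_cut3 A x L y B :
  2 * ((list_weight (A ++ x :: L ++ y :: B))%:R - 1) * bt (A ++ x :: L ++ y :: B) =
    \sum_(Q <- half_left A) bt (Q ++ x :: L ++ y :: B) + cut_left A x (L ++ y :: B)
    + inner_cut A x L y B
    + bt (A ++ x :: L) * bt (y :: B)
    + cut_right (A ++ x :: L) y B
    + \sum_(Q <- half_right B) bt (A ++ x :: L ++ y :: Q).
Proof.
have sumE : \sum_(Q <- half_left (A ++ x :: L)) bt (Q ++ y :: B) =
    2 * red_left A (fun Q z => bt (Q ++ z :: L ++ y :: B)) x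
    + dec (fun z => bt (A ++ z :: L ++ y :: B)) x + inner_cut A x L y B.
  have redE : red_left A (fun Q z => bt ((Q ++ z :: L) ++ y :: B)) x =
              red_left A (fun Q z => bt (Q ++ z :: L ++ y :: B)) x.
    rewrite /red_left /merge_left; congr (_ + _).
      by apply: eq_red => Q; rewrite -catA.
    by case: A => // k A; rewrite -catA.
  have decE : dec (fun z => bt ((A ++ z :: L) ++ y :: B)) x =
              dec (fun z => bt (A ++ z :: L ++ y :: B)) x.
    by case: (x) => //= z; rewrite -catA.
  case: L redE decE => [|l L] redE decE.
    by rewrite (sum_half_left_cat (fun Q => bt (Q ++ y :: B))) redE decE addr0.
  rewrite (sum_half_left_cat2 (fun Q => bt (Q ++ y :: B))) redE decE /inner_cut.
  rewrite -[(A ++ _ :: L) ++ _]catA /=.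
  under eq_bigr => Q _ do rewrite -catA.
  by rewrite /=; ring.
have -> : A ++ x :: L ++ y :: B = (A ++ x :: L) ++ y :: B by rewrite -catA.
rewrite bt_cut; last by apply/eqP; case: A {sumE} => [|k [|j A]]; case: L.
rewrite sumE.
have -> : cut_left (A ++ x :: L) y B = bt (A ++ x :: L) * bt (y :: B) by case: A {sumE}.
have -> : \sum_(Q <- half_right B) bt ((A ++ x :: L) ++ y :: Q)
        = \sum_(Q <- half_right B) bt (A ++ x :: L ++ y :: Q).
  by apply: eq_bigr => Q _; rewrite -catA.
by have := red_left_cut A x (L ++ y :: B); lra.
Qed.

(** * One-entry and prefix estimates *)

Lemma bt_singleS j : j.+2%:R * bt [:: j.+1] = bt [:: j].
Proof.
have := @bt_rec [:: j.+1] isT isT; rewrite /= big_seq1 /list_weight /= addn0 => <-.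
by rewrite -[j.+3%:R]natr1 addrK.
Qed.

Lemma bt_single j : j.+1`!%:R * bt [:: j] = 1.
Proof.
elim: j => [|j IHj]; first by rewrite bt0 mulr1.
by rewrite factS natrM mulrC mulrA [bt _ * _]mulrC bt_singleS mulrC.
Qed.

Lemma bt_cut_end M x : M ++ [:: x] != [:: 0%N] ->
  2 * ((list_weight M)%:R + x%:R + 1) * bt (M ++ [:: x]) =
    \sum_(Q <- half_left M) bt (Q ++ [:: x]) + cut_left M x [::]
    + dec (fun y => bt (M ++ [:: y])) x.
Proof.
move=> H; have := bt_cut H; rewrite big_nil addr0 => <-.
congr (2 * _ * _); rewrite list_weight_cat /list_weight /= addn0 natrD.
by rewrite -[x.+2]addn2 natrD; ring.
Qed.

Lemma bt_cut_mid M x Z : M != [::] -> Z != [::] ->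
  2 * ((list_weight M)%:R + x%:R + 1 + (list_weight Z)%:R) * bt (M ++ x :: Z) =
    \sum_(Q <- half_left M) bt (Q ++ x :: Z) + bt M * bt (x :: Z)
    + bt (M ++ [:: x]) * bt Z + \sum_(Q <- half_right Z) bt (M ++ x :: Q).
Proof.
move=> M0 Z0.
have -> : bt M * bt (x :: Z) = cut_left M x Z by case: M M0.
have -> : bt (M ++ [:: x]) * bt Z = cut_right M x Z by case: Z Z0.
rewrite -bt_cut; last by apply/eqP; case: M M0 => [|k [|j M]].
congr (2 * _ * _); rewrite list_weight_cat list_weight_cons !natrD.
by rewrite -[x.+2]addn2 natrD; ring.
Qed.

Lemma ler_sum_seqZ (s : seq (seq nat)) (c : rat) (F G : seq nat -> rat) :
  (forall Q, Q \in s -> c * F Q <= G Q) ->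
  c * \sum_(Q <- s) F Q <= \sum_(Q <- s) G Q.
Proof.
move=> le_cFG; rewrite mulr_sumr big_seq [leRHS]big_seq.
exact: ler_sum.
Qed.

Lemma ler_sum_seqZr (s : seq (seq nat)) (c : rat) (F G : seq nat -> rat) :
  (forall Q, Q \in s -> F Q <= c * G Q) ->
  \sum_(Q <- s) F Q <= c * \sum_(Q <- s) G Q.
Proof.
move=> le_cFG; rewrite mulr_sumr big_seq [leRHS]big_seq.
exact: ler_sum.
Qed.

(** In the cut recursions of both lists the half sums compare by induction, and the products agree
    exactly by [bt_singleS]; the decrements remain. *)
Lemma bt_end_upper M j : j.+2%:R * bt (M ++ [:: j.+1]) <= bt (M ++ [:: j]).
Proof.
have [n] := ubnP (list_weight M + j)%N; elim: n M j => // n IHn M j le_n.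
have [->|M0] := eqVneq M [::]; first by rewrite /= bt_singleS.
have cutM x : cut_left M x [::] = bt M * bt [:: x] by case: (M) M0.
have neq0 x : M ++ [:: x] != [:: 0%N] by apply/eqP; case: (M) M0 => [|k [|l s]].
have := bt_cut_end (neq0 j.+1); have := bt_cut_end (neq0 j).
rewrite !cutM -(bt_singleS j) /=.
set S0 := \sum_(Q <- _) _; set S1 := \sum_(Q <- _) _.
set X := bt (M ++ [:: j.+1]); set Y := bt (M ++ [:: j]).
set T := dec _ _; set m := bt M; set b := bt [:: j.+1].
have leS : j.+2%:R * S1 <= S0.
  apply: ler_sum_seqZ => Q QM; apply: IHn.
  by have := half_left_weight QM; lia.
(* The weights differ by one, which contributes [2 * Y]; so only j of the j + 2 copies of [Y] must
   be covered by [T]. *)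
have leT : j%:R * Y <= T.
  rewrite /T /Y; case: j le_n {S0 S1 X Y T b leS} => [|j] le_n /=; first by rewrite mul0r.
  apply: le_trans (IHn M j _); last by lia.
  by rewrite ler_wpM2r ?bt_ge0 // ler_nat.
have w0 : 0 < 2 * ((list_weight M)%:R + j.+1%:R + 1) :> rat.
  by rewrite mulr_gt0 // -natrD natr1 ltr0Sn.
move=> E0 E1; rewrite -subr_ge0 -(pmulr_rge0 _ w0).
have jE : j.+1%:R = j%:R + 1 :> rat by rewrite natr1.
have jE2 : j.+2%:R = j%:R + 2 :> rat by rewrite -[j.+2]addn2 natrD.
have -> : 2 * ((list_weight M)%:R + j.+1%:R + 1) * (Y - j.+2%:R * X) =
   2 * ((list_weight M)%:R + j%:R + 1) * Y + 2 * Y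
   - j.+2%:R * (2 * ((list_weight M)%:R + j.+1%:R + 1) * X).
  by rewrite jE; ring.
by rewrite E0 E1; move: leS leT; rewrite jE2; lra.
Qed.

Lemma bt_front_rev x Z : bt (x :: Z) = bt (rev Z ++ [:: x]).
Proof. by rewrite -(bt_rev_cat [::] x Z). Qed.

Lemma bt_front_upper j Z : j.+2%:R * bt (j.+1 :: Z) <= bt (j :: Z).
Proof. by rewrite !bt_front_rev bt_end_upper. Qed.

(** Cutting on both sides of the entry leaves products to which the bounds for an entry at an end
    apply. *)
Lemma bt_inner_upper M j L : j.+2%:R * bt (M ++ j.+1 :: L) <= bt (M ++ j :: L).
Proof.
have [n] := ubnP (list_weight M + list_weight L)%N.
elim: n M L => // n IHn M L le_n.
have [->|M0] := eqVneq M [::]; first exact: bt_front_upper.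
have [->|L0] := eqVneq L [::]; first exact: bt_end_upper.
have := bt_cut_mid j.+1 M0 L0; have := bt_cut_mid j M0 L0.
have : bt M * (j.+2%:R * bt (j.+1 :: L)) <= bt M * bt (j :: L).
  by rewrite ler_wpM2l ?bt_ge0 ?bt_front_upper.
have : j.+2%:R * bt (M ++ [:: j.+1]) * bt L <= bt (M ++ [:: j]) * bt L.
  by rewrite ler_wpM2r ?bt_ge0 ?bt_end_upper.
set S0 := \sum_(Q <- half_left _) bt (Q ++ j :: _).
set S1 := \sum_(Q <- half_left _) _.
set R0 := \sum_(Q <- half_right _) bt (_ ++ j :: _).
set R1 := \sum_(Q <- half_right _) _.
have leS : j.+2%:R * S1 <= S0.
  apply: ler_sum_seqZ => Q QM; apply: IHn.
  by have := half_left_weight QM; lia.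
have leR : j.+2%:R * R1 <= R0.
  apply: ler_sum_seqZ => Q QM; apply: IHn.
  by have := half_right_weight QM; lia.
set X := bt (M ++ j.+1 :: L); set Y := bt (M ++ j :: L).
have X0 : 0 <= j.+2%:R * X by rewrite mulr_ge0 // bt_ge0.
have w0 : 0 < 2 * ((list_weight M)%:R + j%:R + 1 + (list_weight L)%:R) :> rat.
  by rewrite mulr_gt0 // ltr_wpDr // -natrD natr1 ltr0Sn.
move=> H1 H2 E0 E1; rewrite -subr_ge0 -(pmulr_rge0 _ w0).
have jE : j.+1%:R = j%:R + 1 :> rat by rewrite natr1.
have -> : 2 * ((list_weight M)%:R + j%:R + 1 + (list_weight L)%:R) * (Y - j.+2%:R * X) =
   2 * ((list_weight M)%:R + j%:R + 1 + (list_weight L)%:R) * Y + 2 * (j.+2%:R * X)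
   - j.+2%:R * (2 * ((list_weight M)%:R + j.+1%:R + 1 + (list_weight L)%:R) * X).
  by rewrite jE; ring.
by rewrite E0 E1; move: leS leR X0 H1 H2; lra.
Qed.

Lemma bt_end_lower M j : bt (M ++ [:: j]) <= j.+3%:R * bt (M ++ [:: j.+1]).
Proof.
have [n] := ubnP (list_weight M + j)%N; elim: n M j => // n IHn M j le_n.
have [->|M0] := eqVneq M [::].
  by rewrite /= -bt_singleS ler_wpM2r ?bt_ge0 // ler_nat.
have cutM x : cut_left M x [::] = bt M * bt [:: x] by case: (M) M0.
have neq0 x : M ++ [:: x] != [:: 0%N] by apply/eqP; case: (M) M0 => [|k [|l s]].
(* The induction falls short by [bt (M ++ [:: j])]. A surplus copy of [bt M * bt [:: j.+1]] makes up
   for it, since [bt_mul] expands this product into non-negative terms, one of which is the missing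
   one. *)
have leY : bt (M ++ [:: j]) <= bt M * bt [:: j.+1].
  case/lastP: (M) M0 => // A k _; rewrite -cats1 bt_mul /split_sum -catA /=.
  have := bt_ge0 (A ++ [:: (k + j.+1).+1]).
  have : 0 <= dec (fun z => bt (A ++ [:: z; j.+1])) k by case: k => //= k; apply: bt_ge0.
  by lra.
have := bt_cut_end (neq0 j.+1); have := bt_cut_end (neq0 j).
move: leY; rewrite !cutM -(bt_singleS j) /=.
set S0 := \sum_(Q <- _) _; set S1 := \sum_(Q <- _) _.
set X := bt (M ++ [:: j.+1]); set Y := bt (M ++ [:: j]).
set T := dec _ _; set m := bt M; set b := bt [:: j.+1].
have leS : S0 <= j.+3%:R * S1.
  apply: ler_sum_seqZr => Q QM; apply: IHn.
  by have := half_left_weight QM; lia.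
have leT : T <= j.+2%:R * Y.
  rewrite /T /Y; case: j le_n {S0 S1 X Y T b leS} => [|j] le_n /=.
    by rewrite mulr_ge0 ?bt_ge0.
  by apply: (IHn M j); lia.
have w0 : 0 < 2 * ((list_weight M)%:R + j.+1%:R + 1) :> rat.
  by rewrite mulr_gt0 // -natrD natr1 ltr0Sn.
move=> leY E0 E1; rewrite -subr_ge0 -(pmulr_rge0 _ w0).
have jE : j.+1%:R = j%:R + 1 :> rat by rewrite natr1.
have jE2 : j.+2%:R = j%:R + 2 :> rat by rewrite -[j.+2]addn2 natrD.
have jE3 : j.+3%:R = j%:R + 3 :> rat by rewrite -[j.+3]addn3 natrD.
have -> : 2 * ((list_weight M)%:R + j.+1%:R + 1) * (j.+3%:R * X - Y) =
   j.+3%:R * (2 * ((list_weight M)%:R + j.+1%:R + 1) * X)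
   - 2 * ((list_weight M)%:R + j%:R + 1) * Y - 2 * Y.
  by rewrite jE; ring.
by rewrite E0 E1; move: leS leT leY; rewrite jE2 jE3; lra.
Qed.

Lemma bt_front_lower j Z : bt (j :: Z) <= j.+3%:R * bt (j.+1 :: Z).
Proof. by rewrite !bt_front_rev bt_end_lower. Qed.

(** The factorial is the inverse of [bt [:: a.+1]], so equality holds if [M] or [Z] is empty.
    Otherwise the cut recursions of the three lists compare term by term; the weight of the shared
    entry, counted twice on the right, is paid for by the two decrements through the upper
    estimates. *)
Lemma bt_inner_le M a Z :
  bt (M ++ a.+1 :: Z) <= a.+2`!%:R * bt (M ++ [:: a.+1]) * bt (a.+1 :: Z).
Proof.
have [n] := ubnP (list_weight M + list_weight Z)%N.
elim: n M Z => // n IHn M Z le_n.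
have [->|M0] := eqVneq M [::]; first by rewrite /= bt_single mul1r.
have [->|Z0] := eqVneq Z [::].
  by rewrite -mulrA [bt (M ++ _) * _]mulrC mulrA bt_single mul1r.
have neqM x : M ++ [:: x] != [:: 0%N] by apply/eqP; case: (M) M0 => [|k [|l s]].
have neqZ x : x :: Z != [:: 0%N] by apply/eqP; case: (Z) Z0.
have EP := bt_cut_mid a.+1 M0 Z0.
have EM := bt_cut_end (neqM a.+1).
have EZ := @bt_cut [::] a.+1 Z (neqZ _).
have {EM} : 2 * ((list_weight M)%:R + a.+1%:R + 1) * bt (M ++ [:: a.+1]) =
    \sum_(Q <- half_left M) bt (Q ++ [:: a.+1]) + bt M * bt [:: a.+1] + bt (M ++ [:: a]).
  by rewrite EM; case: (M) M0.
have {EZ} : 2 * ((list_weight Z)%:R + a.+1%:R + 1) * bt (a.+1 :: Z) =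
    bt (a :: Z) + bt [:: a.+1] * bt Z + \sum_(Q <- half_right Z) bt (a.+1 :: Q).
  have -> : (list_weight Z)%:R + a.+1%:R + 1 = (list_weight ([::] ++ a.+1 :: Z))%:R - 1 :> rat.
    by rewrite list_weight_cons natrD -[a.+3]addn2 natrD; ring.
  by rewrite EZ big_nil add0r; case: (Z) Z0.
move: EP (bt_end_upper M a) (bt_front_upper a Z) (bt_single a.+1).
set K := _`!%:R; set b := bt [:: a.+1].
set X := bt (M ++ a.+1 :: Z); set bm := bt (M ++ [:: a.+1]); set bz := bt (a.+1 :: Z).
set m := bt M; set z := bt Z; set ym := bt (M ++ [:: a]); set yz := bt (a :: Z).
set SM := \sum_(Q <- half_left _) _; set SZ := \sum_(Q <- half_right _) _.
set sm := \sum_(Q <- half_left _) _; set sz := \sum_(Q <- half_right _) _.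
have leSM : SM <= K * bz * sm.
  apply: ler_sum_seqZr => Q QM; rewrite mulrAC; apply: IHn.
  by have := half_left_weight QM; lia.
have leSZ : SZ <= K * bm * sz.
  apply: ler_sum_seqZr => Q QZ; apply: IHn.
  by have := half_right_weight QZ; lia.
move=> EP Um Uz Kb EZ EM.
have K0 : 0 <= K by [].
have Hm : 0 <= K * bz * (ym - a.+2%:R * bm) by apply: mulr_ge0; [apply: mulr_ge0 (bt_ge0 _)|rewrite subr_ge0].
have Hz : 0 <= K * bm * (yz - a.+2%:R * bz) by apply: mulr_ge0; [apply: mulr_ge0 (bt_ge0 _)|rewrite subr_ge0].
have w0 : 0 < 2 * ((list_weight M)%:R + a.+1%:R + 1 + (list_weight Z)%:R) :> rat.
  by rewrite mulr_gt0 // ltr_wpDr // -natrD natr1 ltr0Sn.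
rewrite -subr_ge0 -(pmulr_rge0 _ w0).
have aE2 : a.+2%:R = a.+1%:R + 1 :> rat by rewrite natr1.
have -> : 2 * ((list_weight M)%:R + a.+1%:R + 1 + (list_weight Z)%:R) * (K * bm * bz - X) =
   K * bz * (2 * ((list_weight M)%:R + a.+1%:R + 1) * bm)
   + K * bm * (2 * ((list_weight Z)%:R + a.+1%:R + 1) * bz)
   - 2 * a.+2%:R * (K * bm * bz)
   - 2 * ((list_weight M)%:R + a.+1%:R + 1 + (list_weight Z)%:R) * X.
  by rewrite aE2; ring.
rewrite EP EM EZ.
have e1 : K * bz * (m * b) = m * bz by rewrite -[RHS]mul1r -Kb; ring.
have e2 : K * bm * (b * z) = bm * z by rewrite -[RHS]mul1r -Kb; ring.
by move: leSM leSZ Hm Hz e1 e2; lra.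
Qed.

(** By [bt_single] this is the ratio of [bt (M ++ [:: k])] to [bt [:: k]], the effect of the prefix
    [M] on a single entry. *)
Definition kappa M k : rat := k.+1`!%:R * bt (M ++ [:: k]).

Lemma kappa_le M i j : (i <= j)%N -> kappa M j <= kappa M i.
Proof.
move/subnK <-; elim: (j - i)%N => // n IHn; apply: le_trans IHn.
rewrite addSn /kappa [(n + i).+2`!]factS natrM -mulrA mulrCA.
by rewrite ler_wpM2l // bt_end_upper.
Qed.

(** Expand [bt_mul] at the cut between a + 1 and k, with and without [M]. The products have ratio
    exactly [kappa M a.+1] and two of the three terms have at most this ratio, so the third has at
    least this ratio. *)
Lemma bt_inner_ge M a k Z :
  kappa M a.+1 * bt (a :: k :: Z) <= bt (M ++ a :: k :: Z).
Proof.
have E0 := bt_mul [::] a.+1 k Z; have E1 := bt_mul M a.+1 k Z.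
rewrite /split_sum /= addSn in E0 E1.
have le1 : dec (fun z => bt (M ++ a.+1 :: z :: Z)) k <=
           kappa M a.+1 * dec (fun z => bt (a.+1 :: z :: Z)) k.
  by case: k {E0 E1} => [|k] /=; rewrite ?mulr0 // bt_inner_le.
have le2 : bt (M ++ (a + k).+2 :: Z) <= kappa M a.+1 * bt ((a + k).+2 :: Z).
  apply: le_trans (bt_inner_le _ _ _) _.
  rewrite ler_wpM2r ?bt_ge0 //; apply: (kappa_le M (i := a.+1)).
  by rewrite ltnS leqW // leq_addr.
have e : kappa M a.+1 * (bt [:: a.+1] * bt (k :: Z)) = bt (M ++ [:: a.+1]) * bt (k :: Z).
  by rewrite /kappa mulrA; congr (_ * _); rewrite mulrAC bt_single mul1r.
rewrite E0 E1 in e.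
by move: le1 le2 e; rewrite !mulrDr; lra.
Qed.

(* The prefix M multiplies bt (a :: k :: Z) by at least kappa M a.+1 and
   bt (b :: Z') by at most kappa M b <= kappa M a.+1. *)
Lemma bt_prefix_lt M a k Z b Z' : (a < b)%N ->
  bt (b :: Z') < bt (a :: k :: Z) -> bt (M ++ b :: Z') < bt (M ++ a :: k :: Z).
Proof.
case: b => // b ab lt_ba.
apply: le_lt_trans (bt_inner_le _ _ _) _; apply: lt_le_trans (bt_inner_ge _ _ _ _).
have k0 : 0 < kappa M a.+1.
  by rewrite mulr_gt0 ?ltr0n ?fact_gt0 // bt_gt0 //; case: M.
rewrite -(ltr_pM2l k0) in lt_ba; apply: le_lt_trans lt_ba.
by rewrite ler_wpM2r ?bt_ge0 //; apply: (kappa_le M (i := a.+1)).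
Qed.

(** * Balanced entries *)

(** Raising the entry m + i by one divides by at least m + i + 2, raising n + i divides by at most n
    + i + 3, and n < m makes the first number at least as large as the second. *)
Lemma bt_trade_le M L N m n k : (n < m)%N ->
  bt (M ++ (m + k)%N :: L) * bt (n :: N) <= bt (M ++ m :: L) * bt ((n + k)%N :: N)
  /\ ((n.+1 < m)%N ->
      bt (M ++ (m + k).+1 :: L) * bt (n :: N) < bt (M ++ m :: L) * bt ((n + k).+1 :: N)).
Proof.
move=> nm.
have step i : bt (M ++ (m + i)%N :: L) * bt (n :: N) <= bt (M ++ m :: L) * bt ((n + i)%N :: N) ->
    (m + i).+2%:R * (bt (M ++ (m + i).+1 :: L) * bt (n :: N))
    <= (n + i).+3%:R * (bt (M ++ m :: L) * bt ((n + i).+1 :: N)).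
  move=> le_i; rewrite mulrA; apply: le_trans (_ : _ <= bt (M ++ (m + i)%N :: L) * bt (n :: N)) _.
    by rewrite ler_wpM2r ?bt_ge0 // bt_inner_upper.
  apply: le_trans le_i _; rewrite [leRHS]mulrCA ler_wpM2l ?bt_ge0 //.
  exact: bt_front_lower.
have le : bt (M ++ (m + k)%N :: L) * bt (n :: N) <= bt (M ++ m :: L) * bt ((n + k)%N :: N).
  elim: k => [|k IHk]; first by rewrite !addn0.
  rewrite !addnS -(ler_pM2l (_ : 0 < (m + k).+2%:R)) ?ltr0n //.
  apply: le_trans (step _ IHk) _.
  apply: ler_wpM2r; first by rewrite mulr_ge0 ?bt_ge0.
  by rewrite ler_nat; lia.
split=> // nm2; rewrite -(ltr_pM2l (_ : 0 < (m + k).+2%:R)) ?ltr0n //.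
apply: le_lt_trans (step _ le) _.
rewrite ltr_pM2r; first by rewrite ltr_nat; lia.
by rewrite mulr_gt0 // bt_gt0 //; case: (M).
Qed.

Definition balanced_gt M m1 L n1 N m2 n2 :=
  bt (M ++ m2 :: L ++ n2 :: N) < bt (M ++ m1 :: L ++ n1 :: N).

Section Induction.
Hypothesis end_swap : forall m n L M, (n < m)%N ->
  bt (M ++ n :: L ++ [:: m.+1]) < bt (M ++ m :: L ++ [:: n.+1]).

Lemma front_swap m n L N : (n < m)%N ->
  bt (m.+1 :: L ++ n :: N) < bt (n.+1 :: L ++ m :: N).
Proof.
move=> nm; have := end_swap (rev L) (rev N) nm.
have revE x y : bt (rev N ++ x :: rev L ++ [:: y]) = bt (y :: L ++ x :: N).
  rewrite -(bt_rev_cat [::] y (L ++ x :: N)) rev_cat rev_cons cat_rcons.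
  by rewrite -catA.
by rewrite !revE.
Qed.

Variable w : nat.
Hypothesis IHw : forall M m1 L n1 N m2 n2,
  (list_weight M + m1 + list_weight L + n1 + list_weight N < w)%N ->
  (m1 + n1 = m2 + n2)%N -> (maxn m1 n1 < maxn m2 n2)%N ->
  balanced_gt M m1 L n1 N m2 n2.

Lemma balanced_gt_left M m1 L n1 N m2 n2 :
  (list_weight M + m1 + list_weight L + n1 + list_weight N < w.+1)%N ->
  (m1 + n1 = m2 + n2)%N -> (m1 < m2)%N -> (n1 < m2)%N ->
  balanced_gt M m1 L n1 N m2 n2.
Proof.
move=> le_w mn m12 nm; rewrite /balanced_gt.
have [nm2|nm2] := leqP m2 n1.+1.
  have m2E : m2 = n1.+1 by lia.
  have m1E : m1 = n2.+1 by lia.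
  have := front_swap L N (_ : (n2 < n1)%N); rewrite -m2E -m1E => /(_ ltac:(lia)).
  (* [bt_prefix_lt] needs a second entry after [m1]: the head of [L], or [n1] if [L] is empty. *)
  by case: L {le_w} => [|l L]; apply: bt_prefix_lt.
have W0 : 0 < 2 * ((list_weight (M ++ m1 :: L ++ n1 :: N))%:R - 1) :> rat.
  rewrite mulr_gt0 // subr_gt0 ltr1n.
  by rewrite !list_weight_cat !list_weight_cons list_weight_cat list_weight_cons; lia.
have WE : list_weight (M ++ m1 :: L ++ n1 :: N) = list_weight (M ++ m2 :: L ++ n2 :: N).
  by rewrite !list_weight_cat !list_weight_cons !list_weight_cat !list_weight_cons; lia.
(* With equal weights it suffices to compare the six terms of the recursion; strictness will come
   from the product across the middle cut. *)
rewrite -(ltr_pM2l W0) {1}WE !bt_cut3.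
have sum_lt (s : seq (seq nat)) (F G : seq nat -> rat) :
    (forall Q, Q \in s -> F Q < G Q) -> \sum_(Q <- s) F Q <= \sum_(Q <- s) G Q.
  by move=> FG; rewrite big_seq [leRHS]big_seq; apply: ler_sum => Q /FG /ltW.
have m1P : m1 = m1.-1.+1 by lia.
have m2P : m2 = m2.-1.+1 by lia.
have n1P : n1 = n1.-1.+1 by lia.
(* Because n1 + 1 < m2, decrementing [m1] and [m2] together keeps the pair with [n2] the less
   balanced one. *)
have lt_dec A : (list_weight A <= list_weight M)%N ->
    dec (fun y => bt (A ++ y :: L ++ n2 :: N)) m2 < dec (fun y => bt (A ++ y :: L ++ n1 :: N)) m1.
  by move=> leA; rewrite m1P m2P; apply: IHw; lia.
have le1 : \sum_(Q <- half_left M) bt (Q ++ m2 :: L ++ n2 :: N)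
        <= \sum_(Q <- half_left M) bt (Q ++ m1 :: L ++ n1 :: N).
  apply: sum_lt => Q QM; have := half_left_weight QM => QM'.
  by apply: IHw; lia.
have le2 : cut_left M m2 (L ++ n2 :: N) <= cut_left M m1 (L ++ n1 :: N).
  rewrite /cut_left; have [M0|M0] := eqVneq M [::].
    by rewrite M0; apply/ltW/(lt_dec [::]).
  case: M M0 le_w {W0 WE lt_dec le1} => // k M _ le_w.
  rewrite ler_wpM2l ?bt_ge0 //; apply/ltW; apply: (IHw (M := [::])); try lia.
  by move: le_w; rewrite list_weight_cons list_weight_nil; lia.
have le3 : inner_cut M m2 L n2 N <= inner_cut M m1 L n1 N.
  rewrite /inner_cut; case: L le_w {W0 WE le1 le2} lt_dec => // l L le_w lt_dec.
  rewrite !lerD ?(ltW (lt_dec M _)) //.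
    rewrite ler_pM2l //; apply/ltW; apply: IHw; try lia.
    by move: le_w; rewrite list_weight_cons; lia.
  apply: sum_lt => Q QL; have := half_left_weight QL => QL'.
  by apply: IHw; lia.
have lt4 : bt (M ++ m2 :: L) * bt (n2 :: N) < bt (M ++ m1 :: L) * bt (n1 :: N).
  (* The amount traded is m2 - m1 = n1 - n2, and m1 - n2 = m2 - n1 > 1 puts this in the strict
     case. *)
  have [_] := @bt_trade_le M L N m1 n2 (m2 - m1).-1 ltac:(lia).
  have -> : (m1 + (m2 - m1).-1).+1 = m2 by lia.
  have -> : (n2 + (m2 - m1).-1).+1 = n1 by lia.
  by apply; lia.
have le5 : cut_right (M ++ m2 :: L) n2 N <= cut_right (M ++ m1 :: L) n1 N.
  rewrite /cut_right; have [N0|N0] := eqVneq N [::].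
    rewrite N0 n1P; case: n2 mn {WE le1 le2 le3 lt4 lt_dec} => [|n2] mn /=; first exact: bt_ge0.
    rewrite -!catA; apply/ltW; apply: IHw; try lia.
    by move: le_w; rewrite N0 list_weight_nil; lia.
  case: N N0 le_w {W0 WE lt_dec le1 le2 le3 lt4} => // k N _ le_w.
  rewrite ler_wpM2r ?bt_ge0 // -!catA; apply/ltW; apply: (IHw (N := [::])); try lia.
  by move: le_w; rewrite list_weight_cons list_weight_nil; lia.
have le6 : \sum_(Q <- half_right N) bt (M ++ m2 :: L ++ n2 :: Q)
        <= \sum_(Q <- half_right N) bt (M ++ m1 :: L ++ n1 :: Q).
  apply: sum_lt => Q QN; have := half_right_weight QN => QN'.
  by apply: IHw; lia.
by move: le1 le2 le3 lt4 le5 le6; lra.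
Qed.

End Induction.

(** For pairs of equal sum, comparing the maxima is the same as comparing the absolute
    differences. *)
Lemma bt_balanced :
  (forall m n L M, (n < m)%N ->
     bt (M ++ n :: L ++ [:: m.+1]) < bt (M ++ m :: L ++ [:: n.+1])) ->
  forall M m1 L n1 N m2 n2, (m1 + n1 = m2 + n2)%N -> (maxn m1 n1 < maxn m2 n2)%N ->
  balanced_gt M m1 L n1 N m2 n2.
Proof.
move=> end_swap M m1 L n1 N m2 n2.
have [w] := ubnP (list_weight M + m1 + list_weight L + n1 + list_weight N)%N.
elim: w M m1 L n1 N m2 n2 => // w IHw M m1 L n1 N m2 n2 le_w mn; rewrite !gtn_max.
rewrite !leq_max => /andP[]; have [n2m2|m2n2] := leqP n2 m2 => H1 H2.
  by apply: (balanced_gt_left end_swap IHw); lia.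
(* If [n2] exceeds [m2], the reversed lists fall under the previous case. *)
have := @balanced_gt_left end_swap w IHw (rev N) n1 (rev L) m1 (rev M) n2 m2.
rewrite /balanced_gt !list_weight_rev.
have revE x y : bt (rev N ++ x :: rev L ++ y :: rev M) = bt (M ++ y :: L ++ x :: N).
  rewrite -(bt_rev_cat M y (L ++ x :: N)) rev_cat rev_cons cat_rcons.
  by rewrite -catA.
by rewrite !revE; apply; lia.
Qed.

(** * Return from normalized values to coefficients of the cd-index *)

Lemma ltr_bt P Q : list_weight P = list_weight Q -> (bt P < bt Q) = (beta_list P < beta_list Q).
Proof.
move=> PQ; rewrite /bt PQ ltr_pM2r ?ltr_int // invr_gt0 ltr0n fact_gt0 //.
Qed.

Theorem theorem7p13 :
  (forall (m n : nat) (L M : seq nat), (n <= m)%N ->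
     beta (ints M ++ m%:Z :: ints L ++ [:: n%:Z])
     > beta (ints M ++ (n%:Z - 1) :: ints L ++ [:: m%:Z + 1])) ->
  forall (m1 n1 m2 n2 : nat) (L M N : seq nat),
    (m1 + n1 = m2 + n2)%N ->
    `|m1%:Z - n1%:Z| < `|m2%:Z - n2%:Z| ->
    beta (ints M ++ m1%:Z :: ints L ++ n1%:Z :: ints N)
    > beta (ints M ++ m2%:Z :: ints L ++ n2%:Z :: ints N).
Proof.
move=> H m1 n1 m2 n2 L M N mn lt12.
have intsE A x B y C : ints A ++ x%:Z :: ints B ++ y%:Z :: ints C
    = ints (A ++ x :: B ++ y :: C).
  by rewrite /ints !map_cat /= map_cat.
rewrite !intsE !beta_ints -ltr_bt; last first.
  by rewrite !list_weight_cat !list_weight_cons !list_weight_cat !list_weight_cons; lia.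
apply: bt_balanced => //; last by lia.
(* The hypothesis is taken at n + 1, so that all entries are non-negative and both sides are values
   of [beta_list]. *)
move=> m n {}L {}M nm; rewrite ltr_bt; last first.
  by rewrite !list_weight_cat !list_weight_cons !list_weight_cat !list_weight_cons; lia.
have := H m n.+1 L M nm.
have -> : n.+1%:Z - 1 = n%:Z by lia.
have -> : m%:Z + 1 = m.+1%:Z by lia.
by rewrite -[[:: n.+1%:Z]]/(n.+1%:Z :: ints [::]) -[[:: m.+1%:Z]]/(m.+1%:Z :: ints [::])
  !intsE !beta_ints.
Qed.
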